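(* If $(a_1,b_1)$ and $(a_2,b_2)$ are bi-Boolean independent pairs in a non-commutative probability space $(\mathcal{A},\varphi)$, then $$\widetilde\eta_{((1+a_1)(1+a_2),\,(1+b_1)(1+b_2))}(z,w)=\widetilde\eta_{(1+a_1,1+b_1)}(z,w)+\frac1{zw}\,\eta_{1+a_1}(z)\cdot\eta_{1+b_1}(w)\cdot\widetilde\eta_{(1+a_2,1+b_2)}(z,w).$$
   Context: All series are formal power series in commuting variables $z,w$. A non-commutative probability space $(\mathcal{A},\varphi)$ is a unital complex algebra with a unital linear functional $\varphi$. For $\chi:\{1,\dots,n\}\to\{\ell,r\}$ with $\chi^{-1}(\{\ell\})=\{i_1<\cdots<i_p\}$ and $\chi^{-1}(\{r\})=\{i_{p+1}>\cdots>i_n\}$, let $\prec_\chi$ be the total order $i_1\prec_\chi\cdots\prec_\chi i_n$; a $\chi$-interval is an interval for $\prec_\chi$. $\mathrm{BI}(\chi)$ is the set of partitions of $\{1,\dots,n\}$ all of whose blocks are $\chi$-intervals. For $V=\{v_1<\cdots<v_s\}$ put $(x_1,\dots,x_n)|_V=(x_{v_1},\dots,x_{v_s})$, and regard $\chi|_V$ as a map on $\{1,\dots,s\}$ via $v_i\leftrightarrow i$. The B-$(\ell,r)$-cumulants are the unique multilinear functionals $B_\chi:\mathcal{A}^n\to\mathbb{C}$ with $\varphi(x_1\cdots x_n)=\sum_{\pi\in\mathrm{BI}(\chi)}\prod_{V\in\pi}B_{\chi|_V}((x_1,\dots,x_n)|_V)$ for all $n\ge1$, $\chi$, $x_1,\dots,x_n$.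 $\chi_{m,n}:\{1,\dots,m+n\}\to\{\ell,r\}$ is $\ell$ on $\{1,\dots,m\}$ and $r$ on $\{m+1,\dots,m+n\}$; $B_{m,n}(x,y)=B_{\chi_{m,n}}(x,\dots,x,y,\dots,y)$ ($m$ copies of $x$, then $n$ copies of $y$); $B_m(x)=B_\chi(x,\dots,x)$ for constant $\chi:\{1,\dots,m\}\to\{\ell,r\}$. The Boolean $\eta$-transform is $\eta_x(z)=\sum_{m\ge1}B_m(x)z^m$, and the reduced bi-Boolean partial $\eta$-transform is $\widetilde\eta_{(x,y)}(z,w)=\sum_{m,n\ge1}B_{m,n}(x,y)z^mw^n$. For $\omega:\{1,\dots,n\}\to K$, $\pi_{\omega,\chi}$ is the unique maximal partition of $\{1,\dots,n\}$ whose blocks are $\chi$-intervals on each of which $\omega$ is constant. For a partition $\pi$, $\varphi_\pi(x_1,\dots,x_n)=\prod_{V=\{v_1<\cdots<v_s\}\in\pi}\varphi(x_{v_1}\cdots x_{v_s})$. A family $\{(\mathcal{A}_{k,\ell},\mathcal{A}_{k,r})\}_{k\in K}$ of pairs of (not required to be unital) subalgebras is bi-Boolean independent if $\varphi(x_1\cdots x_n)=\varphi_{\pi_{\omega,\chi}}(x_1,\dots,x_n)$ for all $n\ge1$, $\chi$, $\omega$, and $x_j\in\mathcal{A}_{\omega(j),\chi(j)}$. Pairs $(a_1,b_1),(a_2,b_2)$ are bi-Boolean independent if the pairs of non-unital algebras $(\mathrm{alg}(a_k),\mathrm{alg}(b_k))$, $k=1,2$, generated by $a_k$ (left) and $b_k$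 (right), are. *)

(* Defs.v *)
From HB Require Import structures.
From mathcomp Require Import all_boot all_order all_algebra.
From mathcomp Require Import boolp.

Set Implicit Arguments.
Unset Strict Implicit.
Unset Printing Implicit Defensive.

Import GRing.Theory.
Local Open Scope ring_scope.

(* * Left/right colourings and bi-interval partitions *)

Inductive side := lft | rgt.

(* The strict order of chi: left positions in increasing order, followed by
   right positions in decreasing order. *)
Definition chi_lt (n : nat) (chi : 'I_n -> side) (i j : 'I_n) : bool :=
  match chi i, chi j with
  | lft, lft => (i < j)%N
  | lft, rgt => true
  | rgt, lft => false
  | rgt, rgt => (j < i)%N
  end.

Definition chi_interval (n : nat) (chi : 'I_n -> side) (V : {set 'I_n}) : bool :=
  [forall i in V, forall k in V, forall j,
     chi_lt chi i j && chi_lt chi j k ==> (j \in V)].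

Definition BI (n : nat) (chi : 'I_n -> side) : {set {set {set 'I_n}}} :=
  [set P | partition P [set: 'I_n] & [forall V in P, chi_interval chi V]].

(* Restriction to V = {v_1 < ... < v_s}: enum_val lists the elements of a set
   of ordinals in increasing order. *)
Definition restr (T : Type) (n : nat) (V : {set 'I_n}) (f : 'I_n -> T) :
  'I_#|V| -> T := fun i => f (enum_val i).
Arguments restr {T n} V f i.

Definition refines (n : nat) (P Q : {set {set 'I_n}}) : bool :=
  [forall V in P, [exists W in Q, V \subset W]].

Definition omega_BI (K : eqType) (n : nat) (omega : 'I_n -> K)
    (chi : 'I_n -> side) : {set {set {set 'I_n}}} :=
  [set P in BI chi |
     [forall V in P, forall i in V, forall j in V, omega i == omega j]].

(* P is pi_(omega, chi); see max_omega_BI_unique. *)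
Definition max_omega_BI (K : eqType) (n : nat) (omega : 'I_n -> K)
    (chi : 'I_n -> side) (P : {set {set 'I_n}}) : Prop :=
  P \in omega_BI omega chi /\
  forall Q, Q \in omega_BI omega chi -> refines P Q -> Q = P.

Section MaxPartition.
Variables (K : eqType) (n : nat) (omega : 'I_n -> K) (chi : 'I_n -> side).

Lemma chi_lt_total i j : [|| i == j, chi_lt chi i j | chi_lt chi j i].
Proof.
by rewrite -val_eqE /chi_lt; case: (chi i) (chi j) => [] [];
  rewrite ?orbT //=; case: ltngtP.
Qed.

Lemma chi_intervalP (V : {set 'I_n}) :
  reflect (forall i k j, i \in V -> k \in V -> chi_lt chi i j ->
             chi_lt chi j k -> j \in V) (chi_interval chi V).
Proof.
apply: (iffP forall_inP) => [h i k j iV kV ij jk|h i iV].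
  by have /forall_inP/(_ k kV)/forallP/(_ j) := h i iV; rewrite ij jk.
apply/forall_inP => k kV; apply/forallP => j; apply/implyP => /andP[].
exact: h.
Qed.

Lemma chi_interval_setU (V W : {set 'I_n}) m :
  chi_interval chi V -> chi_interval chi W -> m \in V -> m \in W ->
  chi_interval chi (V :|: W).
Proof.
move=> /chi_intervalP hV /chi_intervalP hW mV mW.
apply/chi_intervalP => i k j; rewrite !inE => iVW kVW ij jk.
have [/eqP->|/orP[jm|mj]] := orP (chi_lt_total j m); first by rewrite mV.
  by case/orP: iVW => [/hV/(_ mV ij jm)->|/hW/(_ mW ij jm)->]; rewrite ?orbT.
by case/orP: kVW => [/(hV _ _ _ mV)/(_ mj jk)->|/(hW _ _ _ mW)/(_ mj jk)->];
  rewrite ?orbT.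
Qed.

Lemma refines_anti (P Q : {set {set 'I_n}}) :
  partition P [set: 'I_n] -> partition Q [set: 'I_n] ->
  refines P Q -> refines Q P -> P = Q.
Proof.
have sub (P' Q' : {set {set 'I_n}}) : partition P' [set: 'I_n] ->
    refines P' Q' -> refines Q' P' -> P' \subset Q'.
  case/and3P=> _ /trivIsetP tP nP /forall_inP PQ /forall_inP QP.
  apply/subsetP => V VP.
  have /exists_inP[W WQ VW] := PQ V VP.
  have /exists_inP[V' V'P WV'] := QP W WQ.
  have VV' : V = V'.
    apply/eqP; apply: contraNT nP => /(tP _ _ VP V'P).
    rewrite -setI_eq0 (setIidPl (subset_trans VW WV')) => /eqP V0.
    by rewrite -V0.
  by have -> : V = W by apply/eqP; rewrite eqEsubset VW VV'.
by move=> pP pQ PQ QP; apply/eqP; rewrite eqEsubset !sub.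
Qed.

Lemma max_omega_BI_unique : exists! P, max_omega_BI omega chi P.
Proof.
pose good (V : {set 'I_n}) := chi_interval chi V &&
  [forall i in V, forall j in V, omega i == omega j].
pose r i j := [exists V : {set 'I_n}, [&& good V, i \in V & j \in V]].
have goodP V i j : good V -> i \in V -> j \in V -> omega i = omega j.
  case/andP=> _ /forall_inP h iV jV.
  by have /forall_inP/(_ j jV)/eqP := h i iV.
have rxx i : r i i.
  apply/existsP; exists [set i]; rewrite !inE eqxx !andbT; apply/andP; split.
    apply/chi_intervalP => a b j /set1P-> /set1P->.
    by rewrite /chi_lt inE -val_eqE; case: (chi i) (chi j) => [] [] //; case: ltngtP.
  by apply/forall_inP => a /set1P->; apply/forall_inP => b /set1P->.
have rC i j : r i j -> r j i.
  by case/existsP=> V /and3P[gV iV jV]; apply/existsP; exists V; rewrite gV iV jV.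
have rT i j k : r i j -> r j k -> r i k.
  case/existsP=> V /and3P[gV iV jV] /existsP[W /and3P[gW jW kW]].
  apply/existsP; exists (V :|: W); rewrite !inE iV kW orbT /= andbT.
  have oj a : a \in V :|: W -> omega a = omega j.
    by rewrite inE => /orP[aV|aW]; [apply: goodP gV _ _|apply: goodP gW _ _].
  apply/andP; split.
    by case/andP: gV => iV' _; case/andP: gW => iW' _; apply: (chi_interval_setU (m := j)).
  by apply/forall_inP => a /oj->; apply/forall_inP => b /oj->.
have eqr : {in [set: 'I_n] & &, equivalence_rel r}.
  move=> i j k _ _ _; split => // rij.
  by apply/idP/idP; apply: rT => //; apply: rC.
pose E := equivalence_partition r [set: 'I_n].
have pE : partition E [set: 'I_n] := equivalence_partitionP eqr.
have memE V i j : V \in E -> i \in V -> j \in V -> r i j.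
  by case/imsetP=> a _ ->; rewrite !inE /= => ai aj; apply: rT aj; apply: rC.
have Eadm : E \in omega_BI omega chi.
  rewrite !inE pE /=; apply/andP; split.
    apply/forall_inP => V VE; apply/chi_intervalP => i k j iV kV ij jk.
    have /existsP[W /and3P[gW iW kW]] := memE V i k VE iV kV.
    have jW : j \in W.
      by case/andP: gW => /chi_intervalP hW _; apply: hW ij jk.
    have rij : r i j by apply/existsP; exists W; rewrite gW iW jW.
    case/imsetP: VE iV => a _ ->; rewrite !inE /= => ai; exact: rT rij.
  apply/forall_inP => V VE; apply/forall_inP => i iV; apply/forall_inP => j jV.
  have /existsP[W /and3P[gW iW jW]] := memE V i j VE iV jV.
  by rewrite (goodP W i j).
have toE P : P \in omega_BI omega chi -> refines P E.
  rewrite !inE => /andP[/andP[pP /forall_inP iP] /forall_inP oP].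
  apply/forall_inP => V VP.
  have /set0Pn[i iV] : V != set0.
    by apply: contraTneq VP => ->; case/and3P: pP.
  apply/exists_inP; exists [set j in [set: 'I_n] | r i j]; first exact: imset_f.
  apply/subsetP => j jV; rewrite !inE /=; apply/existsP; exists V.
  by rewrite /good iP // oP // iV jV.
have part P : P \in omega_BI omega chi -> partition P [set: 'I_n].
  by rewrite !inE => /andP[/andP[]].
exists E; split.
  split=> // Q Qadm EQ; apply: refines_anti (toE Q Qadm) EQ => //; exact: part.
by move=> P [Padm maxP]; apply: maxP => //; apply: toE.
Qed.

End MaxPartition.

(* * B-(l,r)-cumulants *)

Section Cumulants.
Variables (C : fieldType) (A : algType C) (phi : {scalar A}).

Definition cumulant_family : Type :=
  forall n : nat, ('I_n -> side) -> ('I_n -> A) -> C.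

(* dfwith x u is x with its i-th entry replaced by u. *)
Definition multilinear (n : nat) (f : ('I_n -> A) -> C) : Prop :=
  forall (x : 'I_n -> A) (i : 'I_n) (c : C) (u v : A),
    f (dfwith x (i := i) (c *: u + v)) =
    c * f (dfwith x (i := i) u) + f (dfwith x (i := i) v).

Definition B_cumulants (B : cumulant_family) : Prop :=
  (forall n (chi : 'I_n -> side), (0 < n)%N -> multilinear (B n chi)) /\
  (forall n (chi : 'I_n -> side) (x : 'I_n -> A), (0 < n)%N ->
     phi (\prod_(i < n) x i) =
     \sum_(P in BI chi) \prod_(V in P) B #|V| (restr V chi) (restr V x)).

Lemma dfwithE (n : nat) (x : 'I_n -> A) i u j :
  dfwith x (i := i) u j = if j == i then u else x j.
Proof.
case: eqP => [->|/eqP ji]; first by rewrite dfwith_in.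
by rewrite dfwith_out // eq_sym.
Qed.

Lemma cumulant_family_cast (B : cumulant_family) n m (e : m = n)
    (chi : 'I_n -> side) (chi' : 'I_m -> side) (x : 'I_n -> A) (x' : 'I_m -> A) :
  (forall i, chi' i = chi (cast_ord e i)) ->
  (forall i, x' i = x (cast_ord e i)) -> B m chi' x' = B n chi x.
Proof.
case: n / e chi x => chi x hchi hx.
by congr (B m _ _); apply/funext => i; rewrite ?hchi ?hx cast_ord_id.
Qed.

Lemma cumulant_family_setT (B : cumulant_family) n (chi : 'I_n -> side) x :
  B #|[set: 'I_n]| (restr [set: 'I_n] chi) (restr [set: 'I_n] x) = B n chi x.
Proof.
have e : #|[set: 'I_n]| = n by rewrite cardsT card_ord.
have ev (i : 'I_#|[set: 'I_n]|) : enum_val i = cast_ord e i.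
  apply: val_inj => /=; rewrite (enum_val_nth (cast_ord e i)) enum_setT -enumT.
  by rewrite nth_enum_ord // -[X in (_ < X)%N]e.
by apply: (@cumulant_family_cast B _ _ e) => i; rewrite /restr ev.
Qed.

Lemma BI_setT n (chi : 'I_n -> side) : (0 < n)%N -> [set setT] \in BI chi.
Proof.
move=> n0; rewrite inE; apply/andP; split.
  rewrite /partition /cover /trivIset big_set1 eqxx /= big_set1 /cover big_set1 eqxx /=.
  by rewrite inE eq_sym -card_gt0 cardsT card_ord.
apply/forall_inP => V /set1P->; apply/chi_intervalP => i k j _ _ _ _.
exact: in_setT.
Qed.

Lemma BI_block n (chi : 'I_n -> side) P V :
  P \in BI chi -> P != [set setT] -> V \in P -> (0 < #|V| < n)%N.
Proof.
rewrite inE => /andP[pP _] PT VP; case/and3P: (pP) => _ /trivIsetP tP nP.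
apply/andP; split.
  by rewrite card_gt0; apply: contraNneq nP => <-.
rewrite ltn_neqAle -[X in (_ <= X)%N]card_ord max_card andbT.
apply: contra PT => cV.
have VT : V = setT.
  by apply/eqP; rewrite eqEcard subsetT cardsT card_ord (eqP cV) leqnn.
apply/eqP/setP => W; rewrite inE; apply/idP/eqP => [WP|->]; last by rewrite -VT.
rewrite -VT; apply/eqP; apply: contraNT nP => /(tP _ _ WP VP).
by rewrite VT -setI_eq0 setIT => /eqP <-.
Qed.

Lemma B_cumulants_rec (B : cumulant_family) n (chi : 'I_n -> side) x :
  (0 < n)%N ->
  \sum_(P in BI chi) \prod_(V in P)
    B #|V| (restr V chi) (restr V x) =
  B n chi x + \sum_(P in BI chi | P != [set setT]) \prod_(V in P)
    B #|V| (restr V chi) (restr V x).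
Proof.
move=> n0; rewrite (bigD1 [set setT]) ?BI_setT //= big_set1.
by rewrite cumulant_family_setT.
Qed.

Lemma B_cumulants_unique (B B' : cumulant_family) :
  B_cumulants B -> B_cumulants B' ->
  forall n, (0 < n)%N -> B n = B' n.
Proof.
move=> [_ hB] [_ hB'] n n0; apply/funext => chi; apply/funext => x.
have [k] := ubnP n; elim: k => // k IH in n n0 chi x *; rewrite ltnS => nk.
have := hB n chi x n0; rewrite (hB' n chi x n0) !B_cumulants_rec //.
rewrite [X in B' n chi x + X](_ : _ =
  \sum_(P in BI chi | P != [set setT]) \prod_(V in P)
    B #|V| (restr V chi) (restr V x)) => [/addIr //|].
apply: eq_bigr => P /andP[PB PT]; apply: eq_bigr => V VP.
have /andP[V0 Vn] := BI_block PB PT VP.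
by rewrite IH // (leq_trans Vn nk).
Qed.

Fixpoint Brec (k : nat) : cumulant_family := fun n chi x =>
  if k is k'.+1 then
    phi (\prod_(i < n) x i) -
    \sum_(P in BI chi | P != [set setT]) \prod_(V in P)
      Brec k' (restr V chi) (restr V x)
  else 0.

Lemma Brec_stable k l n (chi : 'I_n -> side) x :
  (n <= k)%N -> (n <= l)%N -> (0 < n)%N -> Brec k chi x = Brec l chi x.
Proof.
elim: k l n chi x => [|k IH] [|l] [|n] chi x // nk nl _ /=.
congr (_ - _); apply: eq_bigr => P /andP[PB PT]; apply: eq_bigr => V VP.
have /andP[V0 Vn] := BI_block PB PT VP.
by apply: IH => //; rewrite -ltnS ?(leq_trans Vn).
Qed.

Lemma multilinear_prod n (x : 'I_n -> A) (i : 'I_n) (c : C) u v :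
  \prod_(j < n) dfwith x (i := i) (c *: u + v) j =
  c *: \prod_(j < n) dfwith x (i := i) u j +
  \prod_(j < n) dfwith x (i := i) v j.
Proof.
have spl w : \prod_(j < n) dfwith x (i := i) w j =
    (\prod_(j <- take i (enum 'I_n)) x j) * w *
    (\prod_(j <- drop i.+1 (enum 'I_n)) x j).
  have -> : index_enum 'I_n = enum 'I_n by rewrite enumT /index_enum unlock.
  have ie : (i < size (enum 'I_n))%N by rewrite size_enum_ord.
  have uE : uniq (enum 'I_n) by exact: enum_uniq.
  have iE : nth i (enum 'I_n) i = i by exact: nth_ord_enum.
  have es : enum 'I_n = take i (enum 'I_n) ++ i :: drop i.+1 (enum 'I_n).
    by rewrite -[LHS](cat_take_drop i) (drop_nth i ie) iE.
  rewrite [X in \prod_(j <- X) _ = _]es big_cat big_cons /= dfwithE eqxx mulrA.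
  move: uE; rewrite [X in uniq X]es.
  rewrite cat_uniq /= => /and3P[_ /norP[it _] /andP[id _]].
  congr (_ * _ * _); apply: eq_big_seq => j jin; rewrite dfwithE ifN //.
    by apply: contraTneq jin => ->.
  by apply: contraTneq jin => ->.
by rewrite !spl mulrDr mulrDl -scalerAr -scalerAl.
Qed.

Lemma restr_dfwith_out n (V : {set 'I_n}) (x : 'I_n -> A) i w :
  i \notin V -> restr V (dfwith x (i := i) w) = restr V x.
Proof.
move=> iV; apply/funext => j; rewrite /restr dfwithE ifN //.
by apply: contraNneq iV => <-; exact: enum_valP.
Qed.

Lemma restr_dfwith_in n (V : {set 'I_n}) (x : 'I_n -> A) i w (iV : i \in V) :
  restr V (dfwith x (i := i) w) =
  dfwith (restr V x) (i := enum_rank_in iV i) w.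
Proof.
apply/funext => j; rewrite /restr !dfwithE.
by rewrite -{1}(enum_rankK_in iV iV) (inj_eq enum_val_inj).
Qed.

Lemma Brec_multilinear k n (chi : 'I_n -> side) : multilinear (Brec k chi).
Proof.
elim: k n chi => [|k IH] n chi x i c u v /=; first by rewrite mulr0 addr0.
rewrite multilinear_prod linearD linearZ /= mulrBr addrACA -opprD; congr (_ - _).
rewrite mulr_sumr -big_split /=; apply: eq_bigr => P /andP[PB PT].
have pP : partition P [set: 'I_n] by move: PB; rewrite inE => /andP[].
have WP : pblock P i \in P by rewrite pblock_mem // (cover_partition pP).
have iW : i \in pblock P i by rewrite mem_pblock (cover_partition pP).
rewrite !(bigD1 _ WP) /= !(restr_dfwith_in _ _ iW) IH mulrDl mulrA.
suff out w : \prod_(V in P | V != pblock P i)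
    Brec k (restr V chi) (restr V (dfwith x (i := i) w)) =
  \prod_(V in P | V != pblock P i)
    Brec k (restr V chi) (restr V x) by rewrite !out.
apply: eq_bigr => V /andP[VP VW]; rewrite restr_dfwith_out //.
apply: contra VW => iV; rewrite eq_sym; apply/eqP.
by apply: def_pblock => //; case/and3P: pP.
Qed.

Lemma BI_const n : BI (fun _ : 'I_n => lft) = BI (fun _ : 'I_n => rgt).
Proof.
have E (V : {set 'I_n}) : chi_interval (fun=> lft) V = chi_interval (fun=> rgt) V.
  by apply/chi_intervalP/chi_intervalP => h i k j iV kV ij jk; apply: (h k i j).
by apply/setP => P; rewrite !inE; congr (_ && _); apply: eq_forallb => V; rewrite E.
Qed.

Lemma B_cumulants_const (B : cumulant_family) n (x : 'I_n -> A) :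
  B_cumulants B -> (0 < n)%N -> B n (fun=> lft) x = B n (fun=> rgt) x.
Proof.
move=> [_ hB]; have [k] := ubnP n; elim: k => // k IH in n x *.
rewrite ltnS => nk n0.
have := hB n (fun=> lft) x n0; rewrite (hB n (fun=> rgt) x n0) !B_cumulants_rec //.
rewrite -BI_const [X in B n (fun=> rgt) x + X](_ : _ =
  \sum_(P in BI (fun _ : 'I_n => lft) | P != [set setT]) \prod_(V in P)
    B #|V| (restr V (fun=> lft)) (restr V x)) => [/addIr //|].
apply: eq_bigr => P /andP[PB PT]; apply: eq_bigr => V VP.
have /andP[V0 Vn] := BI_block PB PT VP.
by rewrite /restr IH // (leq_trans Vn nk).
Qed.

Lemma B_cumulants_exist : exists B, B_cumulants B.
Proof.
exists (fun n => @Brec n n); split=> [n chi _|n chi x n0].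
  exact: Brec_multilinear.
rewrite (B_cumulants_rec (fun n => @Brec n n)) //; case: n n0 chi x => // n _ chi x.
rewrite {1}[Brec]lock -lock /= addrC -[LHS](subrK (\sum_(P in BI chi | P != [set setT])
  \prod_(V in P) Brec n (restr V chi) (restr V x))) addrC.
congr (_ + _); apply: eq_bigr => P /andP[PB PT]; apply: eq_bigr => V VP.
have /andP[V0 Vn] := BI_block PB PT VP.
exact: Brec_stable.
Qed.

(* * Bi-Boolean independence *)

(* The inner product is taken in increasing order of i. *)
Definition phi_part (n : nat) (P : {set {set 'I_n}}) (x : 'I_n -> A) : C :=
  \prod_(V in P) phi (\prod_(i in V) x i).

(* Subalgebras are not required to contain the unit. *)
Definition subalgebra (S : A -> Prop) : Prop :=
  [/\ S 0, forall (c : C) x y, S x -> S y -> S (c *: x + y)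
    & forall x y, S x -> S y -> S (x * y)].

Definition alg (a : A) : A -> Prop :=
  fun x => forall S : A -> Prop, subalgebra S -> S a -> S x.

Lemma alg_subalgebra a : subalgebra (alg a).
Proof.
split=> [S [S0 _ _] _ //|c x y hx hy S sS Sa|x y hx hy S sS Sa].
  by case: (sS) => _ lS _; apply: lS; [apply: hx|apply: hy].
by case: (sS) => _ _ mS; apply: mS; [apply: hx|apply: hy].
Qed.

Definition bi_boolean_independent (K : eqType) (F : K -> side -> A -> Prop) : Prop :=
  (forall k s, subalgebra (F k s)) /\
  forall (n : nat) (chi : 'I_n -> side) (omega : 'I_n -> K) (x : 'I_n -> A)
         (P : {set {set 'I_n}}),
    (0 < n)%N -> (forall j, F (omega j) (chi j) (x j)) ->
    max_omega_BI omega chi P ->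
    phi (\prod_(i < n) x i) = phi_part P x.

(* The index set {1, 2} of the two pairs is bool, with false for 1. *)
Definition bi_boolean_independent_pairs (a1 b1 a2 b2 : A) : Prop :=
  bi_boolean_independent (fun (k : bool) (s : side) =>
    match k, s with
    | false, lft => alg a1
    | false, rgt => alg b1
    | true, lft => alg a2
    | true, rgt => alg b2
    end).

End Cumulants.

(* * Formal power series *)

Section PowerSeries.
Variable C : fieldType.

(* Coefficients of z^m, respectively z^m w^n. *)
Definition fps1 := nat -> C.
Definition fps2 := nat -> nat -> C.

Definition fps_z (f : fps1) : fps2 := fun m n => if n == 0%N then f m else 0.
Definition fps_w (f : fps1) : fps2 := fun m n => if m == 0%N then f n else 0.

Definition fps_add (F G : fps2) : fps2 := fun m n => F m n + G m n.

Definition fps_mul (F G : fps2) : fps2 := fun m n =>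
  \sum_(i < m.+1) \sum_(j < n.+1) F i j * G (m - i)%N (n - j)%N.

Definition fps_zw : fps2 := fun m n => ((m == 1%N) && (n == 1%N))%:R.

(* F / (zw), meaningful when zw divides F; see fps_mul_divzw. *)
Definition fps_divzw (F : fps2) : fps2 := fun m n => F m.+1 n.+1.

Lemma fps_mul_zwE (F : fps2) m n :
  fps_mul fps_zw F m n = if (0 < m)%N && (0 < n)%N then F m.-1 n.-1 else 0.
Proof.
rewrite /fps_mul /fps_zw; case: m => [|m].
  by rewrite big_ord1 big1 // => j _; rewrite mul0r.
case: n => [|n].
  by rewrite big1 // => i _; rewrite big_ord1 andbF mul0r.
rewrite (bigD1 (Ordinal (isT : 1 < m.+2)%N)) //= (bigD1 (Ordinal (isT : 1 < n.+2)%N)) //=.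
rewrite mul1r !subn1 !big1 ?addr0 // => i.
  rewrite -val_eqE /= => /negPf i1; apply: big1 => j _.
  by rewrite i1 mul0r.
by rewrite -val_eqE /= => /negPf->; rewrite mul0r.
Qed.

Lemma fps_mul_divzw (F : fps2) :
  (forall m, F m 0%N = 0) -> (forall n, F 0%N n = 0) ->
  fps_mul fps_zw (fps_divzw F) = F.
Proof.
move=> F0 F0'; apply/funext => m; apply/funext => n; rewrite fps_mul_zwE.
by case: m n => [|m] [|n] //=; rewrite ?F0 ?F0'.
Qed.

Lemma fps_divzwK (F : fps2) : fps_divzw (fps_mul fps_zw F) = F.
Proof. by apply/funext => m; apply/funext => n; rewrite /fps_divzw fps_mul_zwE. Qed.

End PowerSeries.

(* * Eta-transforms *)

Section Eta.
Variables (C : fieldType) (A : algType C) (B : cumulant_family A).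

Definition chi_mn (m n : nat) : 'I_(m + n) -> side :=
  fun i => if (i < m)%N then lft else rgt.

Definition B_mn (m n : nat) (x y : A) : C :=
  B (@chi_mn m n) (fun i : 'I_(m + n) => if (i < m)%N then x else y).

(* The constant map could equally be rgt, by B_cumulants_const. *)
Definition B_m (m : nat) (x : A) : C := B (fun _ : 'I_m => lft) (fun=> x).

Definition eta (x : A) : fps1 C := fun m => if (0 < m)%N then B_m m x else 0.

Definition eta_tilde (x y : A) : fps2 C :=
  fun m n => if (0 < m)%N && (0 < n)%N then B_mn m n x y else 0.

Lemma eta_product_divisible (x1 y1 x2 y2 : A) :
  let F := fps_mul (fps_mul (fps_z (eta x1)) (fps_w (eta y1))) (eta_tilde x2 y2) in
  fps_mul (@fps_zw C) (fps_divzw F) = F.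
Proof.
have et0 m : eta_tilde x2 y2 m 0%N = 0 by rewrite /eta_tilde andbF.
move=> F; apply: fps_mul_divzw => k; rewrite /F {1}/fps_mul.
  by rewrite big1 // => i _; rewrite big_ord1 subn0 et0 mulr0.
by rewrite big_ord1; apply: big1 => j _; rewrite [eta_tilde _ _ _ _]/eta_tilde mulr0.
Qed.

End Eta.

Arguments eta {C A} B x.
Arguments eta_tilde {C A} B x y.

(* Main.v *)
Require Import Defs.
From mathcomp Require Import all_boot all_order all_algebra.
From mathcomp Require Import boolp reals complex.
From mathcomp Require Import zify.

Set Implicit Arguments.
Unset Strict Implicit.
Unset Printing Implicit Defensive.

Import GRing.Theory.
Local Open Scope ring_scope.

(* Put D_0(x) = 1 and D_(n+1)(x) = D_n(x) x - phi(D_n(x) x). Splitting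
   bi-interval partitions at their first block for the chi-order shows that
   B_n(x) = phi(D_(n-1)(x) x) and B_(m,n)(x,y) = phi(D_m(x) D_n(y)).
   Let u = 1 + a_1 and v = 1 + a_2. Bi-Boolean independence says that, inside
   moments, D_n(u) v acts as D_n(u), and D_n(v) u as D_n(v), for n >= 1. By
   induction D_n(uv) therefore acts as
     D_n(u) + sum_(k + l = n + 1) B_k(u) D_l(v)      (k, l >= 1),
   and the same holds on the right for s = 1 + b_1 and t = 1 + b_2. Expanding
   phi(D_m(uv) D_n(st)), the cross terms phi(D_i(u) D_j(t)) and
   phi(D_i(v) D_j(s)) vanish, which is the formula coefficient by coefficient. *)

(** * Boolean cumulants through centering *)

Section Centering.
Variables (C : fieldType) (A : algType C) (phi : {scalar A}).
Hypothesis phi1 : phi 1 = 1.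

(* With P the projection y |-> phi(y) 1, this is x P' x P' ... x P' for
   P' = id - P; the Boolean cumulant is phi(x P' x ... P' x). *)
Fixpoint centered (x : A) (n : nat) : A :=
  if n is k.+1 then centered x k * x - (phi (centered x k * x))%:A else 1.

Definition bool_cumulant (x : A) (n : nat) : C :=
  if n is k.+1 then phi (centered x k * x) else 0.

(** The candidate for $B_{m,n}(x,y)$. A zero index needs its own case: for [m > 0],
    [phi (centered x m * centered y 0)] is [phi (centered x m) = 0], while $B_{m,0}$ is the
    one-variable cumulant of [x]. *)
Definition bibool_cumulant (x y : A) (m n : nat) : C :=
  if m == 0%N then bool_cumulant y n
  else if n == 0%N then bool_cumulant x m
  else phi (centered x m * centered y n).

Lemma phi_algE (c : C) : phi c%:A = c.
Proof. by rewrite linearZ /= phi1 mulr1. Qed.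

Lemma phi_centered x n : (0 < n)%N -> phi (centered x n) = 0.
Proof. by case: n => // n _; rewrite /= linearB /= phi_algE subrr. Qed.

Lemma centered_mulr x n :
  centered x n * x = centered x n.+1 + (bool_cumulant x n.+1)%:A.
Proof. by rewrite /= subrK. Qed.

Lemma centered0 x : centered x 0 = 1. Proof. by []. Qed.

Arguments centered : simpl never.
Arguments bool_cumulant : simpl never.

(** Multiplying [centered x k] by [x] splits off the scalar [bool_cumulant x k.+1]; the letters
    still to come multiply it by a bare power of [x]. *)
Lemma expr_centered_last x n :
  x ^+ n = centered x n + \sum_(k < n) bool_cumulant x k.+1 *: x ^+ (n - k.+1).
Proof.
elim: n => [|n IH]; first by rewrite big_ord0 addr0.
rewrite exprSr {1}IH mulrDl centered_mulr big_ord_recr /= subnn expr0 -addrA.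
congr (_ + _); rewrite addrC; congr (_ + _); rewrite mulr_suml.
by apply: eq_bigr => k _; rewrite -scalerAl -exprSr -subSn.
Qed.

Lemma expr_centered_first y n :
  y ^+ n = \sum_(j < n.+1) phi (y ^+ (n - j)) *: centered y j.
Proof.
elim: n => [|n IH]; first by rewrite big_ord1 expr0 phi1 scale1r.
(* Applying [phi] to [E] kills every [centered y j.+1] and so identifies the scalar part as
   [phi (y ^+ n.+1)], the coefficient wanted at [j = 0]. *)
have E : y ^+ n.+1 = (\sum_(j < n.+1) phi (y ^+ (n - j)) * bool_cumulant y j.+1)%:A
   + \sum_(j < n.+1) phi (y ^+ (n - j)) *: centered y j.+1.
  rewrite exprSr IH mulr_suml addrC scaler_suml -big_split; apply: eq_bigr => j _.
  by rewrite -scalerAl centered_mulr scalerDr scalerA.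
rewrite big_ord_recl {1}E subn0 /= ; congr (_ + _).
rewrite E linearD phi_algE linear_sum [X in _ + X]big1 ?addr0 // => j _.
by rewrite linearZ phi_centered //= mulr0.
Qed.

Lemma phi_expr_first y n : (0 < n)%N ->
  phi (y ^+ n) = \sum_(j < n) bool_cumulant y j.+1 * phi (y ^+ (n - j.+1)).
Proof.
move=> n0; rewrite {1}expr_centered_last linearD phi_centered // add0r linear_sum.
by apply: eq_bigr => j _; rewrite linearZ.
Qed.

(** The two sums are the two shapes of a first block for the chi-order: [k.+1] left letters, or all
    [m] left letters with [j.+1] right ones. The second comes from expanding [y ^+ n] against the
    remainder [centered x m], whose moment with [centered y 0] is zero. *)
Lemma phi_expr_first2 x y m n : (0 < m)%N ->
  phi (x ^+ m * y ^+ n) =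
  \sum_(k < m) bool_cumulant x k.+1 * phi (x ^+ (m - k.+1) * y ^+ n) +
  \sum_(j < n) phi (centered x m * centered y j.+1) * phi (y ^+ (n - j.+1)).
Proof.
move=> m0; rewrite {1}expr_centered_last mulrDl linearD addrC; congr (_ + _).
  by rewrite mulr_suml linear_sum; apply: eq_bigr => k _; rewrite -scalerAl linearZ.
rewrite {1}expr_centered_first big_ord_recl mulrDr linearD /= -scalerAr mulr1 linearZ /=.
rewrite phi_centered // mulr0 add0r mulr_sumr linear_sum; apply: eq_bigr => j _.
by rewrite -scalerAr linearZ /= mulrC.
Qed.

End Centering.

Arguments centered : simpl never.
Arguments bool_cumulant : simpl never.

(* null is the kernel of a pairing stable by right multiplication; modulo it,
   v fixes the centered powers of u, and conversely, as in a Boolean product. *)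
Lemma centered_mul (C : fieldType) (A : algType C) (phi : {scalar A})
    (phi1 : phi 1 = 1) (null : A -> Prop) (u v : A) :
  (forall c x y, null x -> null y -> null (c *: x + y)) ->
  (forall x, null x -> null (x * u)) ->
  (forall x, null x -> null (x * v)) ->
  (forall x, null x -> phi x = 0) -> null 0 ->
  (forall n, (0 < n)%N -> null (centered phi u n * v - centered phi u n)) ->
  (forall n, (0 < n)%N -> null (centered phi v n * u - centered phi v n)) ->
  let eta_u := bool_cumulant phi u in
  forall n, null (centered phi (u * v) n - (centered phi u n +
    \sum_(k < n) eta_u (n - k)%N *: centered phi v k.+1)) /\
    (bool_cumulant phi (u * v) n.+1 =
     \sum_(k < n.+1) eta_u (n.+1 - k)%N * bool_cumulant phi v k.+1).
Proof.
move=> nl nu nv np n0 uP vP eta_u.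
pose D := centered phi; pose g := bool_cumulant phi v.
have nD x y : null x -> null y -> null (x + y).
  by move=> hx hy; rewrite -[x]scale1r; apply: nl.
have nZ c x : null x -> null (c *: x).
  by move=> hx; rewrite -[_ *: _]addr0; apply: nl.
have nS I (r : seq I) (F : I -> A) : (forall i, null (F i)) -> null (\sum_(i <- r) F i).
  by move=> hF; elim/big_rec: _ => // i x _; apply: nD.
pose W n := D u n + \sum_(k < n) eta_u (n - k)%N *: D v k.+1.
pose c n := \sum_(k < n.+1) eta_u (n.+1 - k)%N * g k.+1.
have step n : null (D (u * v) n - W n) ->
    null (D (u * v) n * (u * v) - (W n.+1 + (c n)%:A)).
  move=> h; rewrite [X in null X](_ : _ = (D (u * v) n - W n) * (u * v) +
    (W n * (u * v) - (W n.+1 + (c n)%:A))); last by rewrite mulrBl addrA subrK.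
  apply: (nD); first by rewrite mulrA; apply/nv/nu.
  (* [Y1] and [Y2] collect the errors made when [v] follows [D u n.+1] and when [u] follows
     [D v k.+1]; they are null by [uP] and [vP]. All the rest of [W n * (u * v)] recombines into
     [W n.+1] and a scalar. *)
  pose Y1 := D u n.+1 * v - D u n.+1.
  pose Y2 := \sum_(k < n) eta_u (n - k)%N *: ((D v k.+1 * u - D v k.+1) * v).
  have E1 : D u n * (u * v) =
      D u n.+1 + eta_u n.+1 *: D v 1%N + (eta_u n.+1 * g 1%N)%:A + Y1.
    rewrite mulrA /D centered_mulr mulrDl mulr_algl -/eta_u.
    have := centered_mulr phi v 0; rewrite centered0 mul1r => {2}->.
    rewrite scalerDr scalerA /Y1.
    by rewrite [RHS](AC (3*2) ((1*5)*(4*(2*3)))) /= /D subrr add0r.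
  have E2 : (\sum_(k < n) eta_u (n - k)%N *: D v k.+1) * (u * v) =
      \sum_(k < n) eta_u (n - k)%N *: D v k.+2 +
      (\sum_(k < n) eta_u (n - k)%N * g k.+2)%:A + Y2.
    rewrite scaler_suml mulr_suml -!big_split; apply: eq_bigr => k _ /=.
    rewrite mulrBl -scalerAl -scalerA -!scalerDr; congr (_ *: _).
    by rewrite -(centered_mulr phi v k.+1) mulrA addrC subrK.
  suff -> : W n * (u * v) - (W n.+1 + (c n)%:A) = Y1 + Y2.
    by apply: (nD); [apply: uP | apply: nS => k; apply/nZ/nv/vP].
  rewrite /W /c mulrDl E1 E2 !big_ord_recl /= subn0 scalerDl.
  apply/eqP; rewrite subr_eq; apply/eqP.
  by rewrite (AC (4*3) (4*7*(1*(2*5)*(3*6)))).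
(* As null elements and [W n.+1] have zero moment, applying [phi] to the conclusion of [step] gives
   the cumulant as [c n]; subtracting that scalar completes the induction. *)
have phiW n : phi (W n.+1) = 0.
  rewrite /W linearD phi_centered // add0r linear_sum big1 // => k _.
  by rewrite linearZ phi_centered //= mulr0.
have succ n : null (D (u * v) n - W n) ->
    null (D (u * v) n.+1 - W n.+1) /\ bool_cumulant phi (u * v) n.+1 = c n.
  move/step => h; have cE : bool_cumulant phi (u * v) n.+1 = c n.
    have := np _ h; rewrite linearB linearD phiW phi_algE // add0r.
    by move/eqP; rewrite subr_eq0 => /eqP.
  split=> //; rewrite -cE in h; rewrite [X in null (X - _)]/D.
  move: h; rewrite /D centered_mulr.
  by rewrite opprD addrACA subrr addr0.
have main n : null (D (u * v) n - W n).
  elim: n => [|n IH]; last by case: (succ _ IH).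
  by rewrite /W big_ord0 addr0 subrr.
by move=> n; split; [apply: main | case: (succ _ (main n))].
Qed.

(** * Summing over bi-interval partitions by their first block *)

Section FirstBlock.
Variables (C : fieldType) (N : nat) (chi : 'I_N -> side) (rk : 'I_N -> 'I_N).
Hypothesis rk_lt : forall i j, chi_lt chi i j = (rk i < rk j)%N.

Definition seg (s t : nat) : {set 'I_N} := [set i | (s <= rk i < t)%N].

(** Bi-interval partitions of a final segment of the chi-order: what is left once the blocks below
    rank [s] are removed. This gives a recursion in [s]. *)
Definition seg_BI (s : nat) : {set {set {set 'I_N}}} :=
  [set P | partition P (seg s N) & [forall V in P, chi_interval chi V]].

Lemma rk_inj : injective rk.
Proof.
move=> i j e; have := chi_lt_total chi i j.
by rewrite !rk_lt e ltnn !orbF => /eqP.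
Qed.

Lemma rk_onto t : (t < N)%N -> exists i, rk i = t :> nat.
Proof.
move=> tN; have [g _ gK] := injF_bij rk_inj.
by exists (g (Ordinal tN)); rewrite gK.
Qed.

Lemma seg_BI0 : seg_BI 0 = BI chi.
Proof.
have -> : seg_BI 0 = [set P | partition P [set: 'I_N] &
    [forall V in P, chi_interval chi V]]; last by [].
apply/setP => P; rewrite !inE; congr (partition P _ && _).
by apply/setP => i; rewrite !inE ltn_ord.
Qed.

Lemma seg_BIN : seg_BI N = [set set0].
Proof.
apply/setP => P; rewrite !inE.
have -> : seg N N = set0 by apply/setP => i; rewrite !inE; lia.
rewrite partition_set0; case: eqP => //= ->.
by apply/forall_inP => V; rewrite inE.
Qed.

Lemma seg_interval s t : chi_interval chi (seg s t).
Proof. by apply/chi_intervalP => i k j; rewrite !rk_lt !inE; lia. Qed.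

Lemma seg_inj s t t' : (s <= t < N)%N -> (s <= t' < N)%N ->
  seg s t.+1 = seg s t'.+1 -> t = t'.
Proof.
move=> ht ht' /setP e.
have [i ei] : exists i, rk i = t :> nat by apply: rk_onto; lia.
have [j ej] : exists i, rk i = t' :> nat by apply: rk_onto; lia.
by move: (e i) (e j); rewrite !inE ei ej; lia.
Qed.

(** The block of the element of rank [s] is convex, so it runs from [s] to its largest rank [t]. The
    form with [pred1 t] makes a sum over possible block ends collapse to one term. *)
Lemma seg_BI_first s P : (s < N)%N -> P \in seg_BI s ->
  exists t : 'I_N, (fun t' : 'I_N => (s <= t')%N && (seg s t'.+1 \in P)) =1 pred1 t.
Proof.
move=> sN; rewrite inE => /andP[pP /forall_inP iP].
have [i0 ei0] := rk_onto sN.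
have i0s : i0 \in seg s N by rewrite inE ei0 leqnn.
case/and3P: (pP) => /eqP cP tP _.
have VP : pblock P i0 \in P by rewrite pblock_mem // cP.
have iV : i0 \in pblock P i0 by rewrite mem_pblock cP.
case: (@arg_maxnP _ i0 (mem (pblock P i0)) (fun i => rk i : nat) iV) => j jV jmax.
have sub i : i \in pblock P i0 -> (s <= rk i)%N.
  move=> hi; suff : i \in seg s N by rewrite inE => /andP[].
  by rewrite -cP; apply/bigcupP; exists (pblock P i0).
have E : pblock P i0 = seg s (rk j).+1.
  apply/setP => i; rewrite inE ltnS; apply/idP/andP => [hi|[h1 h2]].
    by split; [exact: sub | exact: jmax].
  have [e1|n1] := eqVneq (rk i : nat) s.
    by rewrite (@rk_inj i i0) //; apply: val_inj; rewrite /= ei0.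
  have [e2|n2] := eqVneq (rk i : nat) (rk j).
    by rewrite (@rk_inj i j) //; apply: val_inj.
  by apply: (chi_intervalP _ _ (iP _ VP) i0 j) => //; rewrite rk_lt; lia.
exists (rk j) => t; apply/andP/eqP => [[st tPs]|->]; last first.
  by rewrite -E; split=> //; exact: sub.
apply: val_inj; apply: (@seg_inj s); rewrite ?st ?ltn_ord ?sub //.
rewrite -E; symmetry; apply: def_pblock => //.
by rewrite inE ei0 leqnn ltnS.
Qed.

(** Removing the first block is inverse to adding it. The conjunct [seg s t.+1 \notin Q] selects the
    [Q] for which the addition can be undone, as the reindexing in [sum_seg_BI] demands. *)
Lemma seg_BI_remove s (t : 'I_N) Q : (s <= t)%N ->
  (seg s t.+1 |: Q \in seg_BI s) && (seg s t.+1 \notin Q) = (Q \in seg_BI t.+1).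
Proof.
move=> st; have tN := ltn_ord t.
have segD : seg s N :\: seg s t.+1 = seg t.+1 N.
  by apply/setP => i; rewrite !inE; lia.
have segU : seg s t.+1 :|: seg t.+1 N = seg s N.
  by apply/setP => i; rewrite !inE; lia.
have dis : [disjoint seg s t.+1 & seg t.+1 N].
  by rewrite -setI_eq0; apply/eqP/setP => i; rewrite !inE; lia.
have seg0 : seg s t.+1 != set0.
  have [i ei] := rk_onto tN; apply/set0Pn; exists i; rewrite inE ei; lia.
rewrite !inE; apply/andP/andP => [[/andP[pP /forall_inP iP] sQ]|[pQ /forall_inP iQ]].
  split; last by apply/forall_inP => V VQ; apply: iP; rewrite !inE VQ orbT.
  by rewrite -segD -[Q](setU1K sQ) partitionD1 // setU11.
split; first (apply/andP; split).
- by rewrite -segU partitionU1.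
- by apply/forall_inP => V; rewrite !inE => /predU1P[->|/iQ//]; exact: seg_interval.
apply: contra seg0 => sQ; rewrite -subset0.
case/and3P: pQ => /eqP cQ _ _.
have := subset_trans (bigcup_sup _ sQ : _ \subset cover Q) (subxx _); rewrite cQ => h.
by move: dis; rewrite -setI_eq0 (setIidPl h) => /eqP->.
Qed.

Lemma sum_seg_BI (h : {set 'I_N} -> C) s : (s < N)%N ->
  \sum_(P in seg_BI s) \prod_(V in P) h V =
  \sum_(s <= t < N) h (seg s t.+1) * \sum_(P in seg_BI t.+1) \prod_(V in P) h V.
Proof.
move=> sN; rewrite big_geq_mkord.
(* Insert a one-term sum over the end of the first block, exchange the sums, then strip that
   block. *)
transitivity (\sum_(P in seg_BI s) \sum_(t < N | (s <= t)%N && (seg s t.+1 \in P))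
    \prod_(V in P) h V).
  by apply: eq_bigr => P /(seg_BI_first sN)[t /(@big_pred1 _ _ _ _ _ _)->].
rewrite (exchange_big_dep (fun t : 'I_N => (s <= t)%N)) /=; last by move=> ? ? _ /andP[].
apply: eq_big => [t|t st]; first by [].
rewrite (reindex_onto (fun Q => seg s t.+1 |: Q) (fun P => P :\ seg s t.+1)) /=; last first.
  by move=> P /and3P[_ _ sP]; rewrite setD1K.
rewrite mulr_sumr; apply: eq_big => [Q|Q].
  rewrite -(@seg_BI_remove s t Q) // st setU11 /= andbT; congr (_ && _).
  apply/eqP/idP => [<-|]; last exact: setU1K.
  by rewrite !inE eqxx.
rewrite st setU11 /= andbT => /andP[_ /eqP eQ]; rewrite big_setU1 //.
by rewrite -eQ !inE eqxx.
Qed.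

End FirstBlock.

(** * Cumulants of the words x^m y^n *)

Section ChiMN.
Variables m n : nat.

Lemma chi_mn_rank_subproof (i : 'I_(m + n)) :
  ((if i < m then i : nat else m + (m + n - i.+1)) < m + n)%N.
Proof. have := ltn_ord i; case: (ltnP i m); lia. Qed.

Definition chi_mn_rank (i : 'I_(m + n)) : 'I_(m + n) :=
  Ordinal (chi_mn_rank_subproof i).

Lemma chi_mn_rank_lt (i j : 'I_(m + n)) :
  chi_lt (@chi_mn m n) i j = (chi_mn_rank i < chi_mn_rank j)%N.
Proof.
have := ltn_ord i; have := ltn_ord j.
by rewrite /chi_lt /chi_mn /=; case: (ltnP i m); case: (ltnP j m); lia.
Qed.

Definition lcount (V : {set 'I_(m + n)}) : nat := #|[set i in V | (i < m)%N]|.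
Definition rcount (V : {set 'I_(m + n)}) : nat := #|[set i in V | (m <= i)%N]|.

Lemma lrcount V : (lcount V + rcount V)%N = #|V|.
Proof.
rewrite -(cardsID [set i : 'I_(m + n) | (i < m)%N] V); congr (_ + _)%N.
  by apply: eq_card => i; rewrite !inE.
by apply: eq_card => i; rewrite !inE -leqNgt andbC.
Qed.

Lemma lcountT : lcount setT = m.
Proof.
rewrite /lcount -sum1dep_card big_split_ord /= [X in (_ + X)%N]big_pred0 => [|i].
  rewrite addn0 (eq_bigl predT) => [|i]; last by rewrite inE ltn_ord.
  by rewrite sum1_card card_ord.
by rewrite inE /=; lia.
Qed.

Lemma rcountT : rcount setT = n.
Proof. by have := lrcount setT; rewrite lcountT cardsT card_ord => /addnI. Qed.

Lemma card_ord_interval k a b : (a <= b)%N ->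
  #|[set i : 'I_k | (a <= i < b)%N]| = (minn k b - minn k a)%N.
Proof.
move=> ab; rewrite -sum1dep_card.
rewrite -(big_mkord (fun i => (a <= i < b)%N) (fun=> 1%N)).
elim: k => [|k IH]; first by rewrite big_geq; lia.
rewrite big_mkcond big_nat_recr //= -big_mkcond /= IH; case: ifP; lia.
Qed.

Lemma lcount_seg s t : (s <= t)%N ->
  lcount (seg chi_mn_rank s t) = (minn m t - minn m s)%N.
Proof.
move=> st; rewrite /lcount /rcount -card_ord_interval // -!sum1dep_card big_split_ord /=.
rewrite [X in (_ + X)%N]big_pred0 => [|i]; last by rewrite !inE /=; lia.
rewrite addn0; apply: eq_bigl => i; rewrite !inE /= ltn_ord; lia.
Qed.

Lemma rcount_seg s t : (s <= t)%N ->
  rcount (seg chi_mn_rank s t) = (minn n (t - m) - minn n (s - m))%N.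
Proof.
move=> st; rewrite /lcount /rcount -card_ord_interval; last by lia.
rewrite -!sum1dep_card big_split_ord /= big_pred0 => [|i]; last first.
  by rewrite !inE /=; have := ltn_ord i; lia.
rewrite add0n (reindex_inj rev_ord_inj); apply: eq_bigl => i; rewrite !inE /=.
have := ltn_ord i; case: ifP; lia.
Qed.

(** The entries below [m] of an increasing list form a prefix. Applied to the elements of a block,
    this shows that [chi_mn] restricted to the block is again of this form, with the left and right
    counts as parameters. *)
Lemma nth_lt_count (s : seq nat) i : sorted ltn s -> (i < size s)%N ->
  (nth 0 s i < m)%N = (i < count (fun k => k < m) s)%N.
Proof.
elim: s i => //= a s IH i aS; have sS := path_sorted aS.
have [am|ma] := ltnP a m; first by case: i => [|i] //; rewrite ltnS => /IH ->.
have h k : k \in a :: s -> (m <= k)%N.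
  rewrite inE => /predU1P[->//|ks].
  by have := allP (order_path_min ltn_trans aS) k ks; rewrite /=; lia.
move=> hi; have -> : count (fun k => (k < m)%N) s = 0%N.
  apply/eqP; rewrite eqn0Ngt -has_count -all_predC; apply/allP => k ks /=.
  by rewrite -leqNgt h // inE ks orbT.
by have := h _ (mem_nth 0%N (hi : i < size (a :: s))%N); rewrite /= add0n; lia.
Qed.

Lemma enum_val_lt (V : {set 'I_(m + n)}) (i : 'I_#|V|) :
  (enum_val i < m)%N = (i < lcount V)%N.
Proof.
have cV : size (map val (enum V)) = #|V| by rewrite size_map cardE.
have -> : enum_val i = nth 0%N (map val (enum V)) i :> nat.
  by rewrite (enum_val_nth (enum_val i)) (nth_map (enum_val i)) // -cardE.
rewrite nth_lt_count ?cV //; last first.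
  apply: (subseq_sorted ltn_trans (s2 := iota 0 (m + n))); last exact: iota_ltn_sorted.
  by rewrite -val_enum_ord map_subseq // enumT filter_subseq.
congr (_ < _)%N; rewrite /lcount -sum1dep_card count_map -sum1_count.
by rewrite big_enum_cond.
Qed.

Lemma B_block (C : fieldType) (A : algType C) (B : cumulant_family A) (x y : A)
    (V : {set 'I_(m + n)}) :
  B #|V| (restr V (@chi_mn m n))
    (restr V (fun i : 'I_(m + n) => if (i < m)%N then x else y)) =
  B_mn B (lcount V) (rcount V) x y.
Proof.
by apply: (@cumulant_family_cast _ _ B _ _ (esym (lrcount V))) => i;
  rewrite /restr /chi_mn enum_val_lt.
Qed.

End ChiMN.

(** * Bi-Boolean cumulants as moments of centered powers *)

Section Cumulants.
Variables (C : fieldType) (A : algType C) (phi : {scalar A}).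
Hypothesis phi1 : phi 1 = 1.

(** Induction on the number of positions of rank at least [s]. The remaining letters form
    [x ^+ (m - s) * y ^+ (n - (s - m))], truncated subtraction covering both [s <= m] and [m <= s].
    The recursion over first blocks is then [phi_expr_first2] or [phi_expr_first]. *)
Lemma phi_expr_seg_BI (x y : A) m n s : (s <= m + n)%N ->
  \sum_(P in seg_BI (@chi_mn m n) (@chi_mn_rank m n) s)
     \prod_(V in P) bibool_cumulant phi x y (lcount V) (rcount V) =
  phi (x ^+ (m - s) * y ^+ (n - (s - m))).
Proof.
have [k] := ubnP (m + n - s); elim: k s => // k IH s; rewrite ltnS => ks.
rewrite leq_eqVlt => /predU1P[->|sN].
  rewrite seg_BIN big_set1 big_set0.
  have -> : (m - (m + n) = 0)%N by lia.
  have -> : (n - (m + n - m) = 0)%N by lia.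
  by rewrite mul1r.
rewrite (sum_seg_BI (@chi_mn_rank_lt m n)) //.
rewrite (eq_big_nat _ _ (F2 := fun t =>
    bibool_cumulant phi x y (minn m t.+1 - minn m s)
       (minn n (t.+1 - m) - minn n (s - m)) *
    phi (x ^+ (m - t.+1) * y ^+ (n - (t.+1 - m))))); last first.
  move=> t /andP[st tN]; rewrite IH ?lcount_seg ?rcount_seg //; lia.
have [sm|ms] := ltnP s m; last first.
  rewrite (_ : (m - s)%N = 0%N) ?mul1r; last by lia.
  rewrite phi_expr_first //; last by lia.
  rewrite -(big_mkord predT (fun j => bool_cumulant phi y j.+1 *
     phi (y ^+ (n - (s - m) - j.+1)))).
  rewrite -{1}[s]add0n big_addn (_ : m + n - s = n - (s - m))%N; last by lia.
  apply: eq_big_nat => j hj.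
  rewrite /bibool_cumulant (_ : (minn m _ - _)%N = 0%N) /=; last by lia.
  rewrite (_ : (minn n _ - _)%N = j.+1); last by lia.
  rewrite (_ : (m - _)%N = 0%N) ?mul1r; last by lia.
  by congr (_ * phi (y ^+ _)); lia.
rewrite (_ : (n - (s - m))%N = n); last by lia.
have ms0 : (0 < m - s)%N by lia.
(* Block ends below [m] give blocks of left letters only; the others take all [m - s] remaining left
   letters and some right ones. *)
rewrite (big_cat_nat (ltnW sm) (leq_addr n m)) phi_expr_first2 //=.
congr (_ + _).
  rewrite -(big_mkord predT (fun j => bool_cumulant phi x j.+1 *
     phi (x ^+ (m - s - j.+1) * y ^+ n))).
  rewrite -{1}[s]add0n big_addn; apply: eq_big_nat => j hj.
  rewrite /bibool_cumulant (_ : (minn m _ - _)%N = j.+1) /=; last by lia.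
  rewrite (_ : (minn n _ - _)%N = 0%N) /=; last by lia.
  by congr (_ * phi (x ^+ _ * y ^+ _)); lia.
rewrite -(big_mkord predT (fun j => phi (centered phi x (m - s) * centered phi y j.+1) *
   phi (y ^+ (n - j.+1)))).
rewrite -{1}[m]add0n big_addn addKn; apply: eq_big_nat => j hj.
rewrite /bibool_cumulant (_ : (minn m _ - _)%N = (m - s)%N) /=; last by lia.
rewrite (_ : (minn n _ - _)%N = j.+1) /=; last by lia.
rewrite (_ : (m - s == 0)%N = false); last by lia.
rewrite (_ : (m - _.+1)%N = 0%N) ?mul1r; last by lia.
by congr (_ * phi (y ^+ _)); lia.
Qed.

Lemma phi_expr_BI (x y : A) m n :
  phi (x ^+ m * y ^+ n) = \sum_(P in BI (@chi_mn m n)) \prod_(V in P)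
    bibool_cumulant phi x y (lcount V) (rcount V).
Proof. by rewrite -(seg_BI0 _ (@chi_mn_rank m n)) phi_expr_seg_BI // sub0n !subn0. Qed.

Lemma prod_mn (x y : A) m n :
  \prod_(i < m + n) (if (i < m)%N then x else y) = x ^+ m * y ^+ n.
Proof.
rewrite big_split_ord /=; congr (_ * _).
  rewrite (eq_bigr (fun=> x)) => [|i _]; last by rewrite ltn_ord.
  by rewrite prodr_const card_ord.
rewrite (eq_bigr (fun=> y)) => [|i _]; last by rewrite ltnNge leq_addr.
by rewrite prodr_const card_ord.
Qed.

Variables (B : cumulant_family A).
Hypothesis B_cumul : B_cumulants phi B.

(** Both sides satisfy the same moment formula. By induction on [m + n] the terms of all partitions
    with more than one block agree, and they cancel. *)
Lemma B_mnE (x y : A) m n : (0 < m + n)%N ->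
  B_mn B m n x y = bibool_cumulant phi x y m n.
Proof.
have [k] := ubnP (m + n); elim: k m n => // k IH m n; rewrite ltnS => mnk mn0.
have := B_cumul.2 _ (@chi_mn m n) (fun i => if (i < m)%N then x else y) mn0.
rewrite prod_mn phi_expr_BI (bigD1 [set setT]) ?BI_setT //= big_set1.
rewrite [RHS](bigD1 [set setT]) ?BI_setT //= big_set1 B_block lcountT rcountT.
rewrite [in RHS](eq_bigr (fun P : {set {set 'I_(m + n)}} => \prod_(V in P)
    bibool_cumulant phi x y (lcount V) (rcount V))) => [/addIr //|P /andP[PB PT]].
apply: eq_bigr => V VP; have /andP[V0 Vn] := BI_block PB PT VP.
by rewrite B_block IH // lrcount // (leq_trans Vn).
Qed.

Lemma etaE (x : A) m : eta B x m = bool_cumulant phi x m.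
Proof.
rewrite /eta; case: m => [|m] //=.
transitivity (B_mn B m.+1 0 x x); last by rewrite B_mnE.
rewrite /B_m /B_mn; apply: (@cumulant_family_cast _ _ B _ _ (esym (addn0 m.+1))) => i /=.
  by rewrite /chi_mn /= ltn_ord.
by rewrite if_same.
Qed.

Lemma eta_tildeE (x y : A) m n : eta_tilde B x y m.+1 n.+1 =
  phi (centered phi x m.+1 * centered phi y n.+1).
Proof. by rewrite /eta_tilde /= B_mnE. Qed.

End Cumulants.

(** * Factorization of moments under bi-Boolean independence *)

Section Keys.
Variables (C : fieldType) (A : algType C) (phi : {scalar A}).
Hypothesis phi1 : phi 1 = 1.
Variables (K : eqType) (F : K -> side -> A -> Prop).
Hypothesis indep : bi_boolean_independent phi F.

(* Only the order of these values matters: on i < n it is the chi-order. *)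
Definition chi_pos (n : nat) (chi : nat -> side) (i : nat) : nat :=
  if chi i is lft then i else (n + n - i)%N.

(* i and j lie in the same block of pi_(omega, chi). *)
Definition linked (n : nat) (chi : nat -> side) (omega : nat -> K) (i j : nat) : bool :=
  [forall k : 'I_n, let p := chi_pos n chi in
    ((p i <= p k <= p j) || (p j <= p k <= p i))%N ==> (omega k == omega i)].

Lemma linkedP n chi omega i j :
  reflect (forall k, (k < n)%N -> let p := chi_pos n chi in
    ((p i <= p k <= p j) || (p j <= p k <= p i))%N -> omega k = omega i)
   (linked n chi omega i j).
Proof.
apply: (iffP forallP) => [h k kn /= hk|h k]; last by apply/implyP => /h ->.
by have /implyP/(_ hk)/eqP := h (Ordinal kn).
Qed.

Lemma linked_refl n chi omega i : (i < n)%N -> linked n chi omega i i.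
Proof.
move=> hi; apply/linkedP => k kn /=; rewrite orbb /chi_pos => h.
by congr omega; move: h; case: (chi i); case: (chi k); lia.
Qed.

Lemma linked_omega n chi omega i j :
  (j < n)%N -> linked n chi omega i j -> omega j = omega i.
Proof. by move=> jn /linkedP/(_ j jn) /= -> //; lia. Qed.

Lemma linked_sym n chi omega i j :
  (j < n)%N -> linked n chi omega i j -> linked n chi omega j i.
Proof.
move=> jn h; apply/linkedP => k kn /= hk.
by rewrite (linked_omega jn h); apply: (linkedP _ _ _ _ _ h); rewrite // orbC.
Qed.

Lemma linked_trans n chi omega i j k : (j < n)%N ->
  linked n chi omega i j -> linked n chi omega j k -> linked n chi omega i k.
Proof.
move=> jn hij hjk; apply/linkedP => l ln /= hl.
have oj := linked_omega jn hij.
move/linkedP: hij => /(_ l ln) /=; move/linkedP: hjk => /(_ l ln) /=; rewrite oj => h1 h2.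
have [h|h] := boolP ((chi_pos n chi i <= chi_pos n chi l <= chi_pos n chi j) ||
  (chi_pos n chi j <= chi_pos n chi l <= chi_pos n chi i))%N; first exact: h2.
apply: h1; lia.
Qed.

(** The key of [i] is the least index linked to it. Naming blocks by numbers lets the blocks of a
    word and of its subwords be compared factor by factor. *)
Lemma linked_key n chi omega : exists2 key : nat -> nat,
  (forall i, (i < n)%N -> (key i < n)%N) &
  (forall i j, (i < n)%N -> (j < n)%N -> (key i == key j) = linked n chi omega i j).
Proof.
pose key i := find (linked n chi omega i) (iota 0 n).
have has_i i : (i < n)%N -> has (linked n chi omega i) (iota 0 n).
  by move=> hi; apply/hasP; exists i; [rewrite mem_iota|exact: linked_refl].
have key_lt i : (i < n)%N -> (key i < n)%N.
  by move=> hi; have := has_i i hi; rewrite has_find size_iota.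
have keyP i : (i < n)%N -> linked n chi omega i (key i).
  move=> hi; have := nth_find 0%N (has_i i hi).
  by rewrite nth_iota ?add0n ?key_lt.
exists key => // i j hi hj; apply/eqP/idP => [e|hij].
  apply: (linked_trans (key_lt _ hi) (keyP i hi)).
  by apply: linked_sym; rewrite ?key_lt // e keyP.
apply: eq_find => k.
apply/idP/idP => h; last exact: linked_trans hj hij h.
by apply: (linked_trans hi) h; exact: linked_sym.
Qed.

Lemma chi_lt_pos n (chi : nat -> side) (i j : 'I_n) :
  chi_lt (fun i : 'I_n => chi i) i j = (chi_pos n chi i < chi_pos n chi j)%N.
Proof.
have := ltn_ord i; have := ltn_ord j; rewrite /chi_lt /chi_pos.
by case: (chi i); case: (chi j); lia.
Qed.

(** Linkedness tests all positions between two indices, so its classes are chi-intervals with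
    constant [omega]. Conversely, a block of any admissible partition is convex with constant
    [omega], so its elements are pairwise linked. *)
Lemma max_omega_BI_key n chi omega (key : nat -> nat) :
  (forall i j, (i < n)%N -> (j < n)%N -> (key i == key j) = linked n chi omega i j) ->
  max_omega_BI (fun i : 'I_n => omega i) (fun i : 'I_n => chi i)
    (preim_partition (fun i : 'I_n => key i) [set: 'I_n]).
Proof.
move=> keyP; set P := preim_partition _ _.
have pP : partition P [set: 'I_n] := preim_partitionP _ _.
have memP V (i j : 'I_n) : V \in P -> i \in V -> j \in V -> key i = key j.
  by case/imsetP=> a _ ->; rewrite !inE /= => /eqP <- /eqP <-.
have PP : P \in omega_BI (fun i : 'I_n => omega i) (fun i : 'I_n => chi i).
  rewrite !inE pP /=; apply/andP; split; apply/forall_inP => V VP.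
    apply/chi_intervalP => i k j iV kV; rewrite !chi_lt_pos => ij jk.
    have /eqP := memP V i k VP iV kV; rewrite keyP // => ik.
    have {}ik : linked n chi omega i j.
      apply/linkedP => l ln /= hl; apply: (linkedP _ _ _ _ _ ik) => //=.
      by lia.
    case/imsetP: VP iV => a _ ->; rewrite !inE /= => /eqP ->.
    by rewrite keyP.
  apply/forall_inP => i iV; apply/forall_inP => j jV.
  have /eqP := memP V j i VP jV iV; rewrite keyP // => h.
  by rewrite (linked_omega _ h).
split=> // Q; rewrite !inE => /andP[/andP[pQ /forall_inP iQ] /forall_inP oQ] PQ.
symmetry; apply: refines_anti => //; apply/forall_inP => V VQ.
have /set0Pn[i iV] : V != set0.
  by apply: contraTneq VQ => ->; case/and3P: pQ.
apply/exists_inP; exists [set j in [set: 'I_n] | key i == key j]; first exact: imset_f.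
apply/subsetP => j jV; rewrite !inE /= keyP //; apply/linkedP => k kn /= hk.
suff kV : Ordinal kn \in V by have /forall_inP/(_ i iV)/eqP := forall_inP (oQ V VQ) _ kV.
have h1 (a b : 'I_n) : (chi_pos n chi a <= chi_pos n chi b)%N ->
    a = b \/ chi_lt (fun i : 'I_n => chi i) a b.
  have [/eqP->|/orP[h _|]] := orP (chi_lt_total (fun i : 'I_n => chi i) a b).
  - by left.
  - by right.
  - by rewrite chi_lt_pos; lia.
case/orP: hk => /andP[].
  case/(h1 i (Ordinal kn)) => [<-//|ik] /(h1 (Ordinal kn) j) [->//|kj].
  exact: (chi_intervalP _ _ (iQ V VQ) i j).
case/(h1 j (Ordinal kn)) => [<-//|ik] /(h1 (Ordinal kn) i) [->//|kj].
exact: (chi_intervalP _ _ (iQ V VQ) j i).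
Qed.

(** The independence formula with a factor for each [v < N]; values that are not keys contribute
    [phi 1 = 1]. A common [N] gives words of different lengths the same index range. *)
Lemma phi_prod_key n chi omega (x : nat -> A) (key : nat -> nat) N :
  (forall i, (i < n)%N -> F (omega i) (chi i) (x i)) ->
  (forall i, (i < n)%N -> (key i < N)%N) ->
  (forall i j, (i < n)%N -> (j < n)%N -> (key i == key j) = linked n chi omega i j) ->
  phi (\prod_(0 <= i < n) x i) =
  \prod_(v < N) phi (\prod_(0 <= i < n | key i == v) x i).
Proof.
move=> hF kN keyP; have [n0|n0] := posnP n.
  by rewrite n0 big_geq // phi1 big1 // => v _; rewrite big_geq.
rewrite big_mkord (indep.2 _ _ _ _ _ n0 _ (max_omega_BI_key keyP)) /phi_part; last first.
  by move=> j; apply: hF.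
pose kappa (i : 'I_n) : 'I_N := Ordinal (kN i (ltn_ord i)).
pose blk (v : 'I_N) : {set 'I_n} := [set i : 'I_n | key i == v].
have -> : preim_partition (fun i : 'I_n => key i) [set: 'I_n] = [set blk v | v in codom kappa].
  apply/setP => V; apply/imsetP/imsetP => [[i _ ->]|[v /codomP[i ->] ->]].
    exists (kappa i); first exact: codom_f.
    by apply/setP => j; rewrite !inE /= eq_sym.
  by exists i => //; apply/setP => j; rewrite !inE /= eq_sym.
rewrite big_imset /=; last first.
  move=> v w /codomP[i ->] /codomP[j ->] /setP/(_ i); rewrite !inE eqxx => /esym/eqP e.
  exact: val_inj.
rewrite [RHS](bigID [in codom kappa]) /= [X in _ * X]big1 ?mulr1 => [|v vk].
  apply: eq_bigr => v _; rewrite big_mkord; congr (phi _); apply: eq_bigl => i.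
  by rewrite inE.
rewrite big_mkord big_pred0 // => i; apply: contraNF vk => /eqP e.
by apply/codomP; exists i; apply: val_inj.
Qed.

End Keys.

(** * Splitting off a subword at one end of the chi-order *)

Section WordSplit.
Variables (C : fieldType) (A : algType C) (phi : {scalar A}).
Hypothesis phi1 : phi 1 = 1.
Variables (K : eqType) (F : K -> side -> A -> Prop).
Hypothesis indep : bi_boolean_independent phi F.

Lemma chi_pos_embed n n' (chi : nat -> side) (h : nat -> nat) :
  (forall i j, (i < j < n')%N -> (h i < h j)%N) ->
  (forall i, (i < n')%N -> (h i < n)%N) ->
  forall i j, (i < n')%N -> (j < n')%N ->
  (chi_pos n chi (h i) <= chi_pos n chi (h j))%N =
  (chi_pos n' (chi \o h) i <= chi_pos n' (chi \o h) j)%N.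
Proof.
move=> hm hb i j hi hj; have := hb i hi; have := hb j hj.
have mono a b : (a < n')%N -> (b < n')%N -> (h a <= h b)%N = (a <= b)%N.
  by move=> ha hb'; have := hm a b; have := hm b a; case: (ltngtP a b) => [||->]; lia.
have := mono _ _ hi hj; have := mono _ _ hj hi.
by rewrite /chi_pos /=; case: (chi (h i)); case: (chi (h j)); lia.
Qed.

(** By the third hypothesis the image of [h] is a chi-interval, so the positions between two of its
    letters all belong to the subword. *)
Lemma linked_embed n n' (chi : nat -> side) (omega : nat -> K) (h : nat -> nat) :
  (forall i j, (i < j < n')%N -> (h i < h j)%N) ->
  (forall i, (i < n')%N -> (h i < n)%N) ->
  (forall k, (k < n)%N -> (exists2 l, (l < n')%N & h l = k) \/
     (forall i, (i < n')%N -> chi_pos n chi (h i) < chi_pos n chi k)%N \/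
     (forall i, (i < n')%N -> chi_pos n chi k < chi_pos n chi (h i))%N) ->
  forall i j, (i < n')%N -> (j < n')%N ->
  linked n chi omega (h i) (h j) = linked n' (chi \o h) (omega \o h) i j.
Proof.
move=> hm hb hc i j hi hj; have pE := fun a b => chi_pos_embed chi (i := a) (j := b) hm hb.
apply/linkedP/linkedP => H k kn /= hk.
  by apply: H; rewrite ?hb //= !pE.
have [[l ln e]|hk'] := hc k kn.
  by subst k; apply: (H l ln); rewrite /= -!pE.
by case: hk' => h'; have := h' _ hi; have := h' _ hj; lia.
Qed.

Variable X : K -> side -> A.
Hypothesis FX : forall k s, F k s (X k s).

Definition word_prod (s : seq (side * K)) : A := \prod_(l <- s) X l.2 l.1.

(** Since [s2] lies at one end of the chi-order, [s2] and [s1 ++ s3] are both chi-intervals and keep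
    their links. No link crosses, so every block lies in one of them and the product over keys
    factors. *)
Lemma phi_word_split l0 (s1 s2 s3 : seq (side * K)) :
  let s := s1 ++ s2 ++ s3 in let p := size s1 in let k := size s2 in
  let chi i := (nth l0 s i).1 in let omega i := (nth l0 s i).2 in
  let pos := chi_pos (size s) chi in
  let g i := if (i < p)%N then i else (i + k)%N in
  (forall i j, (i < k)%N -> (j < p + size s3)%N -> (pos (p + i) < pos (g j))%N) \/
  (forall i j, (i < k)%N -> (j < p + size s3)%N -> (pos (g j) < pos (p + i))%N) ->
  (forall i j, (i < k)%N -> (j < p + size s3)%N ->
     ~~ linked (size s) chi omega (p + i) (g j)) ->
  phi (word_prod s) = phi (word_prod s2) * phi (word_prod (s1 ++ s3)).
Proof.
move=> s p k chi omega pos g conv nolink.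
pose q := size s3; have sE : size s = (p + k + q)%N by rewrite !size_cat addnA.
pose x i := X (omega i) (chi i).
have [key key_lt keyP] := linked_key (size s) chi omega.
have mid : word_prod s2 = \prod_(0 <= i < k) x (p + i)%N.
  rewrite /word_prod (big_nth l0); apply: eq_big_nat => i /andP[_ ik].
  by rewrite /x /omega /chi /s nth_cat ltnNge leq_addr /= addKn nth_cat ik.
have out : word_prod (s1 ++ s3) = \prod_(0 <= i < p + q) x (g i).
  rewrite /word_prod (big_nth l0) size_cat; apply: eq_big_nat => i /andP[_ ik].
  rewrite /x /omega /chi /s /g !nth_cat -/p; case: ltnP => ip; first by rewrite ip.
  have e1 : (i + k < p)%N = false by lia.
  have e2 : (i + k - p < k)%N = false by lia.
  have e3 : (i + k - p - k = i - p)%N by lia.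
  by rewrite -/k e1 e2 e3.
have g_lt i : (i < p + q)%N -> (g i < size s)%N by rewrite /g; case: ifP; lia.
have f_lt i : (i < k)%N -> (p + i < size s)%N by lia.
have cover i : (i < size s)%N -> (exists2 l, (l < k)%N & (p + l)%N = i) \/
    (exists2 l, (l < p + q)%N & g l = i).
  move=> hi; have [ip|pi] := ltnP i p; first by right; exists i; rewrite /g ?ip //; lia.
  have [ik|ki] := ltnP i (p + k); first by left; exists (i - p)%N; lia.
  by right; exists (i - k)%N; rewrite /g; [lia | case: ifP; lia].
rewrite mid out {1}/word_prod (big_nth l0).
rewrite (@phi_prod_key _ _ _ phi1 _ _ indep _ chi omega x key (size s)) //.
rewrite (@phi_prod_key _ _ _ phi1 _ _ indep k (chi \o (addn p)) (omega \o (addn p))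
  (x \o addn p) (key \o addn p) (size s)) //; first last.
- move=> i j ik jk; rewrite /= keyP ?f_lt //; apply: linked_embed => // [|l ls]; first by lia.
  have [[m mk e]|[m mk e]] := cover l ls; first by left; exists m.
  by right; subst l; case: conv => conv; [left|right] => m' hm'; exact: conv.
- by move=> i ik; apply/key_lt/f_lt.
rewrite (@phi_prod_key _ _ _ phi1 _ _ indep (p + q) (chi \o g) (omega \o g)
  (x \o g) (key \o g) (size s)) //; first last.
- move=> i j ik jk; rewrite /= keyP ?g_lt //.
  apply: linked_embed => // [i' j' hij|l ls].
    by rewrite /g; case: ifP; case: ifP; lia.
  have [[m mk e]|[m mk e]] := cover l ls; last by left; exists m.
  by right; subst l; case: conv => conv; [right|left] => m' hm'; exact: conv.
- by move=> i ik; apply/key_lt/g_lt.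
rewrite -big_split; apply: eq_bigr => -[v _] _ /=.
rewrite sE (big_cat_nat (leq0n _) (leq_addr q (p + k))).
rewrite (big_cat_nat (leq0n _) (leq_addr k p)) [in RHS](big_cat_nat (leq0n _) (leq_addr q p)) /=.
have -> : \prod_(0 <= i < p | key (g i) == v) x (g i) =
    \prod_(0 <= i < p | key i == v) x i.
  rewrite big_nat_cond [RHS]big_nat_cond; apply: eq_big => i.
    by apply: andb_id2l => /andP[_ ip]; rewrite /g ip.
  by case/andP=> /andP[_ ip] _; rewrite /g ip.
have -> : \prod_(p <= i < p + q | key (g i) == v) x (g i) =
    \prod_(p + k <= i < p + k + q | key i == v) x i.
  rewrite [RHS]big_addn (_ : p + k + q - k = p + q)%N; last by lia.
  rewrite big_nat_cond [RHS]big_nat_cond; apply: eq_big => i.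
    by apply: andb_id2l => /andP[pi _]; rewrite /g ltnNge pi.
  by case/andP=> /andP[pi _] _; rewrite /g ltnNge pi.
have -> : \prod_(p <= i < p + k | key i == v) x i =
    \prod_(0 <= i < k | key (p + i)%N == v) x (p + i)%N.
  rewrite -{1}[p]add0n big_addn addKn; apply: eq_big => i; by rewrite addnC.
(* If [v] is a key in the middle, the two outer products are empty; otherwise the middle one is.
   Either way one factor on the right is [phi 1]. *)
case: (boolP (has (fun i => key (p + i)%N == v) (iota 0 k))) => [/hasP|/hasPn none].
  case=> i; rewrite mem_iota add0n => /andP[_ ik] /eqP kv.
  have nokey j : (j < p + q)%N -> (key (g j) == v) = false.
    by move=> hj; rewrite -kv eq_sym keyP ?f_lt ?g_lt //; apply/negbTE/nolink.
  have -> : \prod_(0 <= j < p | key j == v) x j = 1.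
    rewrite big_nat_cond big_pred0 // => j; apply/negbTE/negP => /andP[/andP[_ jp]].
    by have := nokey j; rewrite /g jp => ->; lia.
  have -> : \prod_(p + k <= j < p + k + q | key j == v) x j = 1.
    rewrite big_nat_cond big_pred0 // => j; apply/negbTE/negP => /andP[/andP[pj jp]].
    have := nokey (j - k)%N; rewrite /g (_ : (j - k < p)%N = false); last by lia.
    by rewrite subnK; [move=> ->; lia | lia].
  by rewrite !mul1r !mulr1 phi1 mulr1.
have -> : \prod_(0 <= i < k | key (p + i)%N == v) x (p + i)%N = 1.
  rewrite big_nat_cond big_pred0 // => i; apply/negbTE/negP => /andP[/andP[_ ik]].
  by apply/negP/none; rewrite mem_iota.
by rewrite mulr1 phi1 mul1r.
Qed.

End WordSplit.

(** * Factoring out powers of a single letter *)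

Section Runs.
Variables (C : fieldType) (A : algType C) (phi : {scalar A}).
Hypothesis phi1 : phi 1 = 1.
Variables (K : eqType) (F : K -> side -> A -> Prop).
Hypothesis indep : bi_boolean_independent phi F.
Variable X : K -> side -> A.
Hypothesis FX : forall k s, F k s (X k s).

Definition side_word (s : side) (w : seq K) : A := \prod_(c <- w) X c s.
Notation lword := (side_word lft).
Notation rword := (side_word rgt).

Lemma side_word_cons s c w : side_word s (c :: w) = X c s * side_word s w.
Proof. exact: big_cons. Qed.

Lemma side_word0 s : side_word s [::] = 1.
Proof. exact: big_nil. Qed.

Lemma word_prod_map s w : word_prod X (map (pair s) w) = side_word s w.
Proof. by rewrite /word_prod big_map. Qed.

Lemma side_word_nseq s c k : side_word s (nseq k c) = X c s ^+ k.
Proof. by elim: k => [|k IH]; rewrite ?side_word0 //= side_word_cons IH exprS. Qed.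

Lemma word_prod_cat s1 s2 : word_prod X (s1 ++ s2) = word_prod X s1 * word_prod X s2.
Proof. exact: big_cat. Qed.

Lemma word_prod_nseq s c k : word_prod X (nseq k (s, c)) = X c s ^+ k.
Proof. by rewrite -side_word_nseq -word_prod_map map_nseq. Qed.

Lemma word_prod_cons l s : word_prod X (l :: s) = X l.2 l.1 * word_prod X s.
Proof. exact: big_cons. Qed.

(** An initial run of left letters is first in the chi-order. Its successor, at position [k],
    belongs to another pair, so no block joins the run to the rest. *)
Lemma phi_word_left_run c d k s3 : c != d -> ohead s3 = Some (lft, d) ->
  phi (word_prod X (nseq k (lft, c) ++ s3)) =
  phi (word_prod X (nseq k (lft, c))) * phi (word_prod X s3).
Proof.
move=> cd hd; pose l0 := (lft, c); pose s := nseq k l0 ++ s3.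
have s3_gt0 : (0 < size s3)%N by case: s3 hd @s.
have sE : size s = (k + size s3)%N by rewrite size_cat size_nseq.
pose chi i := (nth l0 s i).1; pose pos := chi_pos (size s) chi.
have ei i : (i < k)%N -> nth l0 s i = (lft, c).
  by move=> ik; rewrite nth_cat size_nseq ik nth_nseq ik.
have ek : nth l0 s k = (lft, d).
  by rewrite nth_cat size_nseq ltnn subnn; case: s3 hd @s s3_gt0 {sE ei chi pos} => //= a s [->].
have posi i : (i < k)%N -> pos i = i by move=> ik; rewrite /pos /chi_pos /chi ei.
have posk : pos k = k by rewrite /pos /chi_pos /chi ek.
have posg j : (j < size s3)%N -> (k <= pos (j + k))%N.
  by rewrite /pos /chi_pos sE; case: (chi _); lia.
apply: (@phi_word_split _ _ _ phi1 _ _ indep _ FX l0 [::] (nseq k l0) s3).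
  rewrite size_nseq /= -/s -/chi -/pos; left=> i j ik /posg jk.
  by rewrite add0n posi //; lia.
rewrite size_nseq /= -/s -/chi -/pos => i j ik jn.
have ks : (k < size s)%N by rewrite sE; lia.
apply/negP => /linkedP/(_ k ks) H; move/eqP: cd; apply.
rewrite ek add0n ei // in H; rewrite [RHS]H //= -/pos.
by rewrite posi // posk; have := posg j jn; lia.
Qed.

Lemma phi_word_right_run c d k w s3 : c != d ->
  ohead s3 = Some (rgt, d) \/ [/\ s3 = [::], w != [::] & last d w = d] ->
  let s1 := map (pair lft) w in
  phi (word_prod X (s1 ++ nseq k (rgt, c) ++ s3)) =
  phi (word_prod X (nseq k (rgt, c))) * phi (word_prod X (s1 ++ s3)).
Proof.
move=> cd hd s1; pose l0 := (lft, d); pose s := s1 ++ nseq k (rgt, c) ++ s3; pose p := size s1.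
have sE : size s = (p + k + size s3)%N by rewrite !size_cat size_nseq addnA.
pose chi i := (nth l0 s i).1; pose pos := chi_pos (size s) chi.
have el i : (i < p)%N -> chi i = lft.
  by move=> ip; rewrite /chi nth_cat -/p ip (nth_map d) // -(size_map (pair lft)).
have ei i : (i < k)%N -> nth l0 s (p + i) = (rgt, c).
  by move=> ik; rewrite nth_cat -/p ltnNge leq_addr addKn nth_cat size_nseq ik nth_nseq ik.
have posi i : (i < k)%N -> pos (p + i)%N = (size s + size s - (p + i))%N.
  by move=> ik; rewrite /pos /chi_pos /chi ei.
have posl i : (i < p)%N -> pos i = i by move=> ip; rewrite /pos /chi_pos el.
have posr i : (i < size s3)%N -> (pos (p + k + i) <= size s + size s - (p + k))%N.
  by rewrite /pos /chi_pos sE; case: (chi _); lia.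
pose g i := if (i < p)%N then i else (i + k)%N.
have gE j : (j < p + size s3)%N ->
    [\/ (j < p)%N /\ g j = j | (0 < size s3)%N /\ exists2 l, (l < size s3)%N & g j = (p + k + l)%N].
  move=> hj; rewrite /g; case: ltnP => jp; first by left.
  by right; split; [|exists (j - p)%N]; lia.
(* The run comes last in the chi-order, right positions being read backwards. The barrier [b] is the
   position just before it: the head of [s3] if this is a right letter, the last left letter if [s3]
   is empty. *)
have [b bs [eb posb posb']] : exists2 b, (b < size s)%N & [/\ (nth l0 s b).2 = d,
    forall i, (i < k)%N -> (pos b <= pos (p + i))%N
    & forall j, (j < p + size s3)%N -> (pos (g j) <= pos b)%N].
  case: hd => [hd|[e0 e1 e2]].
    have s3_gt0 : (0 < size s3)%N by case: s3 hd @s @g {gE sE ei posi el posl posr chi pos}.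
    have ek : nth l0 s (p + k) = (rgt, d).
      rewrite nth_cat -/p ltnNge leq_addr addKn nth_cat size_nseq ltnn subnn.
      by case: s3 hd {s s3_gt0 gE sE ei posi el posl posr chi pos} => //= a s [->].
    have posk : pos (p + k)%N = (size s + size s - (p + k))%N.
      by rewrite /pos /chi_pos /chi ek.
    exists (p + k)%N; first by rewrite sE; lia.
    split; first by rewrite ek.
      by move=> i ik; rewrite posk posi //; lia.
    move=> j /gE[[jp ->]|[_ [l ls ->]]]; last by rewrite posk posr.
    by rewrite posk posl // sE; lia.
  have p_gt0 : (0 < p)%N by rewrite /p size_map lt0n size_eq0.
  have q0 : size s3 = 0%N by rewrite e0.
  exists p.-1; first by rewrite sE; lia.
  split; first by rewrite nth_cat -/p prednK // leqnn nth_last last_map e2.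
    by move=> i ik; rewrite posi // posl ?sE; lia.
  by move=> j /gE[[jp ->]|[]]; [rewrite !posl; lia | lia].
apply: (@phi_word_split _ _ _ phi1 _ _ indep _ FX l0 s1 (nseq k (rgt, c)) s3).
  rewrite size_nseq -/s -/p -/chi -/pos; right=> i j ik jn; rewrite -/(g j).
  have := posi i ik; rewrite sE; case: (gE j jn) => [[jp ->]|[_ [l ls ->]]].
    by rewrite (posl j) //; lia.
  by have := posr l ls; rewrite sE; lia.
rewrite size_nseq -/s -/p -/chi -/pos => i j ik jn.
apply/negP => /linkedP/(_ b bs) H; move/eqP: cd; apply.
rewrite eb ei // in H; rewrite H //=.
by rewrite -/pos -/(g j) posb // posb' // orbT.
Qed.

Lemma phi_left_run c d k w w' : c != d ->
  phi (X c lft ^+ k * X d lft * lword w * rword w') =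
  phi (X c lft ^+ k) * phi (X d lft * lword w * rword w').
Proof.
move=> cd; have := @phi_word_left_run c d k
  ((lft, d) :: map (pair lft) w ++ map (pair rgt) w') cd erefl.
by rewrite word_prod_cat word_prod_nseq word_prod_cons word_prod_cat !word_prod_map /= !mulrA.
Qed.

Lemma phi_right_run c d k w w' : c != d ->
  phi (lword w * (X c rgt ^+ k * X d rgt) * rword w') =
  phi (X c rgt ^+ k) * phi (lword w * X d rgt * rword w').
Proof.
move=> cd; have := @phi_word_right_run c d k w
  ((rgt, d) :: map (pair rgt) w') cd (or_introl erefl).
rewrite /= !word_prod_cat word_prod_nseq word_prod_cons !word_prod_map /= !mulrA.
by [].
Qed.

Lemma phi_mixed_run c d i j : c != d ->
  phi (X d lft ^+ i * X c rgt ^+ j) = phi (X d lft ^+ i) * phi (X c rgt ^+ j).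
Proof.
move=> cd; case: i => [|i]; first by rewrite expr0 mul1r phi1 mul1r.
rewrite [RHS]mulrC; have := @phi_word_right_run c d j (nseq i.+1 d) [::] cd; cbv zeta.
rewrite !cats0 word_prod_cat map_nseq !word_prod_nseq; apply.
by right; split=> //; elim: i => /=.
Qed.

End Runs.

(** * The product formula *)

Section CenteredSpan.
Variables (C : fieldType) (A : algType C) (phi : {scalar A}).
Variable S : A -> Prop.
Hypothesis S_lin : forall c x y, S x -> S y -> S (c *: x + y).

Lemma centered_ind (x : A) : S 1 -> (forall p, S p -> S (p * x)) ->
  forall n, S (centered phi x n).
Proof.
move=> S1 Sx; elim=> [//|n IH]; rewrite -[centered _ _ _](addrK (bool_cumulant phi x n.+1)%:A).
rewrite -centered_mulr addrC -scaleNr; exact: S_lin (Sx _ IH).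
Qed.

(** [centered phi (1 + a) n] is a polynomial in [a], so a linear condition can be checked on powers
    of [a]. The factor [a ^+ j] carried in the induction absorbs the multiplication by [1 + a]. *)
Lemma centered_span (a : A) : (forall j, S (a ^+ j)) ->
  forall n, S (centered phi (1 + a) n).
Proof.
move=> Sa n; suff : forall j, S (centered phi (1 + a) n * a ^+ j).
  by move/(_ 0%N); rewrite mulr1.
elim: n => [|n IH] j; first by rewrite mul1r.
rewrite -[centered _ _ _](addrK (bool_cumulant phi (1 + a) n.+1)%:A) -centered_mulr.
rewrite mulrBl mulr_algl addrC -scaleNr; apply: S_lin => //.
rewrite mulrDr mulr1 mulrDl -mulrA -exprS.
by rewrite -[X in X + _]scale1r; exact: S_lin.
Qed.

End CenteredSpan.

(** * Multiplicativity of centered powers inside moments *)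

Section Product.
Variables (C : fieldType) (A : algType C) (phi : {scalar A}).
Hypothesis phi1 : phi 1 = 1.
Variables (K : eqType) (F : K -> side -> A -> Prop).
Hypothesis indep : bi_boolean_independent phi F.
Variable X : K -> side -> A.
Hypothesis FX : forall k s, F k s (X k s).

Notation lword := (side_word X lft).
Notation rword := (side_word X rgt).
Notation D := (centered phi).
Let T (c : K) (s : side) : A := 1 + X c s.

(** Equality modulo [null_left], for elements followed by left and then right letters, and modulo
    [null_right], for elements standing between them, makes precise that two elements act alike
    inside moments. *)
Definition null_left (e : A) : Prop := forall w w', phi (e * lword w * rword w') = 0.
Definition null_right (e : A) : Prop := forall w w', phi (lword w * e * rword w') = 0.

Lemma null_left_lin c x y : null_left x -> null_left y -> null_left (c *: x + y).
Proof.
move=> hx hy w w'.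
by rewrite !mulrDl -!scalerAl linearD linearZ /= hx hy mulr0 addr0.
Qed.

Lemma null_right_lin c x y : null_right x -> null_right y -> null_right (c *: x + y).
Proof.
move=> hx hy w w'.
by rewrite mulrDr mulrDl -scalerAr -scalerAl linearD linearZ /= hx hy mulr0 addr0.
Qed.

Lemma null_left_mulr c x : null_left x -> null_left (x * T c lft).
Proof.
move=> hx w w'; rewrite mulrDr mulr1 !mulrDl linearD /= hx add0r.
by have := hx (c :: w) w'; rewrite side_word_cons !mulrA.
Qed.

Lemma null_right_mulr c x : null_right x -> null_right (x * T c rgt).
Proof.
move=> hx w w'; rewrite mulrDr mulr1 mulrDr mulrDl linearD /= hx add0r.
by have := hx w (c :: w'); rewrite side_word_cons !mulrA.
Qed.

Lemma null_left_phi x : null_left x -> phi x = 0.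
Proof. by move=> /(_ [::] [::]); rewrite !side_word0 !mulr1. Qed.

Lemma null_right_phi x : null_right x -> phi x = 0.
Proof. by move=> /(_ [::] [::]); rewrite !side_word0 mulr1 mul1r. Qed.

(** The difference is [D (T c lft) n * X d lft]. A power of [X c lft] in front of [X d lft] factors
    out of the moment; by linearity so does [D (T c lft) n], whose moment is zero. *)
Lemma null_left_run c d n : c != d -> (0 < n)%N ->
  null_left (D (T c lft) n * T d lft - D (T c lft) n).
Proof.
move=> cd n0 w w'; rewrite mulrDr mulr1 addrC addKr.
have h : phi (D (T c lft) n * X d lft * lword w * rword w') =
    phi (D (T c lft) n) * phi (X d lft * lword w * rword w').
  apply: (@centered_span _ _ _ (fun p => phi (p * X d lft * lword w * rword w') =
    phi p * phi (X d lft * lword w * rword w'))) => [e x y hx hy|j].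
    by rewrite !mulrDl -!scalerAl !linearD !linearZ /= hx hy mulrDl mulrA.
  exact: (phi_left_run phi1 indep FX).
by rewrite h phi_centered ?mul0r.
Qed.

Lemma null_right_run c d n : c != d -> (0 < n)%N ->
  null_right (D (T c rgt) n * T d rgt - D (T c rgt) n).
Proof.
move=> cd n0 w w'; rewrite [Z in Z - _]mulrDr mulr1 addrC addKr.
have h : phi (lword w * (D (T c rgt) n * X d rgt) * rword w') =
    phi (D (T c rgt) n) * phi (lword w * X d rgt * rword w').
  apply: (@centered_span _ _ _ (fun p => phi (lword w * (p * X d rgt) * rword w') =
    phi p * phi (lword w * X d rgt * rword w'))) => [e x y hx hy|j].
    by rewrite mulrDl mulrDr mulrDl -scalerAl -scalerAr -scalerAl !linearD !linearZ
      /= hx hy mulrDl mulrA.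
  exact: (phi_right_run phi1 indep FX).
by rewrite h phi_centered ?mul0r.
Qed.

Lemma phi_centered_mixed c d m n : c != d -> (0 < m)%N ->
  phi (D (T d lft) m * D (T c rgt) n) = 0.
Proof.
move=> cd m0.
suff -> : phi (D (T d lft) m * D (T c rgt) n) = phi (D (T d lft) m) * phi (D (T c rgt) n).
  by rewrite phi_centered ?mul0r.
apply: (@centered_span _ _ _ (fun p => phi (p * _) = phi p * phi _)) => [e x y hx hy|i].
  by rewrite mulrDl -scalerAl !linearD !linearZ /= hx hy mulrDl mulrA.
apply: (@centered_span _ _ _ (fun q => phi (_ * q) = phi _ * phi q)) => [e x y hx hy|j].
  by rewrite mulrDr -scalerAr !linearD !linearZ /= hx hy mulrDr mulrCA.
exact: (phi_mixed_run phi1 indep FX).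
Qed.

(** The right factor is a polynomial in right letters, which are absorbed one at a time into the
    trailing word [w']. *)
Lemma phi_null_left e (c d : K) n : null_left e ->
  phi (e * D (T c rgt * T d rgt) n) = 0.
Proof.
move=> he; suff : forall w', phi (e * D (T c rgt * T d rgt) n * rword w') = 0.
  by move/(_ [::]); rewrite side_word0 mulr1.
apply: (@centered_ind _ _ _ (fun q => forall w', phi (e * q * rword w') = 0)).
- move=> a x y hx hy w'; rewrite mulrDr mulrDl -scalerAr -scalerAl linearD linearZ /=.
  by rewrite hx hy mulr0 addr0.
- by move=> w'; have := he [::] w'; rewrite side_word0.
have step b p : (forall w', phi (e * p * rword w') = 0) ->
    forall w', phi (e * (p * T b rgt) * rword w') = 0.
  move=> hp w'; rewrite mulrDr mulr1 mulrDr mulrDl linearD /= hp add0r.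
  by have := hp (b :: w'); rewrite side_word_cons !mulrA.
by move=> p hp w'; rewrite [p * _]mulrA; exact: (step d _ (step c p hp)).
Qed.

Lemma phi_null_right e (c : K) n : null_right e -> phi (D (T c lft) n * e) = 0.
Proof.
move=> he; apply: (@centered_span _ _ _ (fun p => phi (p * e) = 0)) => [a x y hx hy|j].
  by rewrite mulrDl -scalerAl linearD linearZ /= hx hy mulr0 addr0.
by have := he (nseq j c) [::]; rewrite side_word0 mulr1 side_word_nseq.
Qed.

Variables c d : K.
Hypothesis cd : c != d.

Notation eta := (bool_cumulant phi).
Let W (s : side) (n : nat) : A :=
  D (T c s) n + \sum_(k < n) eta (T c s) (n - k)%N *: D (T d s) k.+1.

Lemma null_left_mul n : null_left (D (T c lft * T d lft) n - W lft n).
Proof.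
have dc : d != c by rewrite eq_sym.
apply: (centered_mul phi1 (null := null_left) (u := T c lft) (v := T d lft) _ _ _ _ _ _ _ n).1.
- exact: null_left_lin.
- exact: null_left_mulr.
- exact: null_left_mulr.
- exact: null_left_phi.
- by move=> w w'; rewrite !mul0r linear0.
- by move=> k; exact: null_left_run.
- by move=> k; exact: null_left_run.
Qed.

Lemma null_right_mul n : null_right (D (T c rgt * T d rgt) n - W rgt n).
Proof.
have dc : d != c by rewrite eq_sym.
apply: (centered_mul phi1 (null := null_right) (u := T c rgt) (v := T d rgt) _ _ _ _ _ _ _ n).1.
- exact: null_right_lin.
- exact: null_right_mulr.
- exact: null_right_mulr.
- exact: null_right_phi.
- by move=> w w'; rewrite mulr0 mul0r linear0.
- by move=> k; exact: null_right_run.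
- by move=> k; exact: null_right_run.
Qed.

Lemma phi_centered_mul m n : (0 < m)%N -> (0 < n)%N ->
  phi (D (T c lft * T d lft) m * D (T c rgt * T d rgt) n) =
  phi (D (T c lft) m * D (T c rgt) n) +
  \sum_(k < m) \sum_(l < n) eta (T c lft) (m - k)%N * eta (T c rgt) (n - l)%N *
    phi (D (T d lft) k.+1 * D (T d rgt) l.+1).
Proof.
move=> m0 n0; have dc : d != c by rewrite eq_sym.
(* The left factor is replaced first, against a polynomial in right letters; the right factor is
   then replaced against [W lft m], a combination of centered powers of [T c lft] and [T d lft]. *)
transitivity (phi (W lft m * D (T c rgt * T d rgt) n)).
  apply/eqP; rewrite -subr_eq0 -linearB -mulrBl /=; apply/eqP.
  by apply: phi_null_left; exact: null_left_mul.
transitivity (phi (W lft m * W rgt n)).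
  apply/eqP; rewrite -subr_eq0 -linearB -mulrBr /=; apply/eqP.
  rewrite mulrDl linearD phi_null_right ?add0r; last exact: null_right_mul.
  rewrite mulr_suml linear_sum big1 // => k _.
  by rewrite -scalerAl linearZ /= phi_null_right ?mulr0 //; exact: null_right_mul.
rewrite mulrDl mulrDr !linearD /= -addrA; congr (_ + _).
(* Here, and again in the sum over [k], the cross terms between the left side of one pair and the
   right side of the other vanish. *)
rewrite mulr_sumr linear_sum big1 ?add0r => [|l _]; last first.
  by rewrite -scalerAr linearZ /= phi_centered_mixed ?mulr0.
rewrite mulr_suml linear_sum; apply: eq_bigr => k _.
rewrite -scalerAl linearZ /= mulrDr linearD phi_centered_mixed // add0r.
rewrite mulr_sumr linear_sum mulr_sumr; apply: eq_bigr => l _.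
by rewrite -scalerAr linearZ /= mulrA.
Qed.

End Product.

(** * Coefficients of the power series *)

Section Series.
Variable C : fieldType.

Lemma fps_mul_zwE2 (f g : fps1 C) m n : fps_mul (fps_z f) (fps_w g) m n = f m * g n.
Proof.
rewrite /fps_mul /fps_z /fps_w big_ord_recr big1 ?add0r => [|i _] /=; last first.
  have mi : (m - i == 0)%N = false by have := ltn_ord i; lia.
  by rewrite big1 // => j _; rewrite mi mulr0.
rewrite big_ord_recl big1 ?addr0 => [|j _] /=; last by rewrite mul0r.
by rewrite subnn subn0 add0r.
Qed.

Lemma sum_inner m (H : nat -> C) : H 0%N = 0 -> H m.+1 = 0 ->
  \sum_(i < m.+2) H i = \sum_(k < m) H (m - k)%N.
Proof.
move=> H0 Hm; rewrite big_ord_recl big_ord_recr /= H0 Hm addr0 add0r.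
rewrite (reindex_inj rev_ord_inj); apply: eq_bigr => k _ /=.
by congr H; have := ltn_ord k; rewrite /bump; lia.
Qed.

(** Division by $zw$ moves to degree $(m+1, n+1)$, split as $(m-k)+(k+1)$ and $(n-l)+(l+1)$. The end
    terms of the convolution drop because no factor has terms of degree zero. *)
Lemma fps_divzw_prod (f g : fps1 C) (G : fps2 C) m n :
  f 0%N = 0 -> g 0%N = 0 -> (forall i, G i 0%N = 0) -> (forall j, G 0%N j = 0) ->
  fps_divzw (fps_mul (fps_mul (fps_z f) (fps_w g)) G) m n =
  \sum_(k < m) \sum_(l < n) f (m - k)%N * g (n - l)%N * G k.+1 l.+1.
Proof.
move=> f0 g0 G0 G0'; rewrite /fps_divzw {1}/fps_mul.
rewrite (@sum_inner m (fun i => \sum_(j < n.+2)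
    fps_mul (fps_z f) (fps_w g) i j * G (m.+1 - i)%N (n.+1 - j)%N)); first last.
- by rewrite big1 // => j _; rewrite subnn G0' mulr0.
- by rewrite big1 // => j _; rewrite fps_mul_zwE2 f0 !mul0r.
apply: eq_bigr => k _; have := ltn_ord k => km.
rewrite (@sum_inner n (fun j =>
    fps_mul (fps_z f) (fps_w g) (m - k)%N j * G (m.+1 - (m - k))%N (n.+1 - j)%N)); first last.
- by rewrite subnn G0 mulr0.
- by rewrite fps_mul_zwE2 g0 mulr0 mul0r.
apply: eq_bigr => l _; have ln := ltn_ord l; rewrite fps_mul_zwE2.
by congr (_ * G _ _); lia.
Qed.

End Series.

Theorem theorem4p15 (R : realType) (A : algType R[i]) (phi : {scalar A})
    (phi_unital : phi 1 = 1)
    (B : cumulant_family A) (B_cumul : B_cumulants phi B)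
    (a1 b1 a2 b2 : A)
    (indep : bi_boolean_independent_pairs phi a1 b1 a2 b2) :
  eta_tilde B ((1 + a1) * (1 + a2)) ((1 + b1) * (1 + b2)) =
  fps_add (eta_tilde B (1 + a1) (1 + b1))
    (fps_divzw
       (fps_mul (fps_mul (fps_z (eta B (1 + a1))) (fps_w (eta B (1 + b1))))
          (eta_tilde B (1 + a2) (1 + b2)))).
Proof.
apply/funext => m; apply/funext => n.
have et0 x y i : eta_tilde B x y i 0%N = 0 by rewrite /eta_tilde andbF.
rewrite /fps_add fps_divzw_prod //.
(* For [m = 0] or [n = 0] both sides are zero: [eta_tilde] is zero there by convention and the
   double sum is empty. *)
case: m => [|m]; first by rewrite big_ord0 addr0.
case: n => [|n]; first by rewrite !et0 add0r big1 // => k _; rewrite big_ord0.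
pose X (k : bool) (s : side) : A :=
  match k, s with
  | false, lft => a1 | false, rgt => b1 | true, lft => a2 | true, rgt => b2
  end.
rewrite !(eta_tildeE phi_unital B_cumul).
have FX : forall k s, match k, s with
    | false, lft => alg a1 | false, rgt => alg b1
    | true, lft => alg a2 | true, rgt => alg b2 end (X k s).
  by move=> [] [] S _.
(* The index [false] is the first pair, giving the left-hand factors [1 + a1] and [1 + b1] of the
   two products. *)
rewrite (phi_centered_mul phi_unital indep FX (c := false) (d := true)) //.
congr (_ + _); apply: eq_bigr => k _; apply: eq_bigr => l _.
by rewrite !(etaE phi_unital B_cumul) (eta_tildeE phi_unital B_cumul).
Qed.
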